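(* Let $\Bbbk\supseteq\mathbb{Q}$ be a field. The ring $D^\infty(\Bbbk[x,y])\subset\Bbbk[\![x,y]\!]$ (which is regular, local and Henselian) does not admit the Weierstrass preparation.
   Context: For variables $z=(z_1,\dots,z_n)$ and a differential $\Bbbk$-subalgebra $\Bbbk[z]\subseteq R\subseteq\Bbbk[\![z]\!]$ (closed under all $\partial_{z_i}$), $D(R)$ denotes the set of all $f\in\Bbbk[\![z]\!]$ such that the $\mathrm{Frac}(R)$-vector subspace of $\mathrm{Frac}(\Bbbk[\![z]\!])$ spanned by all the partial derivatives of $f$ of all orders is finite dimensional. It is again a differential subalgebra. Put $D^1(R)=D(R)$, $D^{j+1}(R)=D(D^j(R))$, $D^\infty(R)=\bigcup_j D^j(R)$. Here $x,y$ are single variables, $D^\infty(\Bbbk[x,y])\subset\Bbbk[\![x,y]\!]$ and $D^\infty(\Bbbk[x])\subset\Bbbk[\![x]\!]$. ''Admits the Weierstrass preparation'' means: every $F(x,y)\in D^\infty(\Bbbk[x,y])$ with $F(0,y)\ne0$ of order $d$ in $y$ can be presented as $F=u\cdot(y^d+h_1(x)y^{d-1}+\cdots+h_d(x))$ with $u\in D^\infty(\Bbbk[x,y])$, $u(0,0)\neq0$, and $h_i(x)\in D^\infty(\Bbbk[x])$, $h_i(0)=0$. *)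

(* Defs.v *)
From HB Require Import structures.
From mathcomp Require Import all_boot all_order all_algebra.
From mathcomp Require Import fraction boolp classical_sets.

Set Implicit Arguments.
Unset Strict Implicit.
Unset Printing Implicit Defensive.

Import GRing.Theory.
Local Open Scope classical_set_scope.
Local Open Scope ring_scope.

(** Formal power series in one variable.  [fps (fps k)] plays the role of
    k[[x, y]] = k[[x]][[y]]: the coefficient of x^i y^j in F is
    [coef (coef F j) i]. *)

Record fps (R : Type) := Fps { coef : nat -> R }.

Section FpsRing.
Variable R : comNzRingType.
Implicit Types f g h : fps R.

HB.instance Definition _ := gen_eqMixin (fps R).
HB.instance Definition _ := gen_choiceMixin (fps R).

Lemma fpsP f g : (forall n, coef f n = coef g n) -> f = g.
Proof. by case: f => f; case: g => g /= fg; congr Fps; apply/funext. Qed.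

Definition fps_zero : fps R := Fps (fun=> 0).
Definition fps_opp f := Fps (fun n => - coef f n).
Definition fps_add f g := Fps (fun n => coef f n + coef g n).

Fact fps_addA : associative fps_add.
Proof. by move=> f g h; apply: fpsP => n /=; rewrite addrA. Qed.
Fact fps_addC : commutative fps_add.
Proof. by move=> f g; apply: fpsP => n /=; rewrite addrC. Qed.
Fact fps_add0 : left_id fps_zero fps_add.
Proof. by move=> f; apply: fpsP => n /=; rewrite add0r. Qed.
Fact fps_addN : left_inverse fps_zero fps_opp fps_add.
Proof. by move=> f; apply: fpsP => n /=; rewrite addNr. Qed.

HB.instance Definition _ :=
  GRing.isZmodule.Build (fps R) fps_addA fps_addC fps_add0 fps_addN.

Definition fps_const (c : R) := Fps (fun n => if n == 0%N then c else 0).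
Definition fps_mul f g :=
  Fps (fun n => \sum_(i < n.+1) coef f i * coef g (n - i)%N).

Definition fps_trunc n f : {poly R} := \poly_(i < n.+1) coef f i.

Lemma coef_fps_mul n m f g :
  (m <= n)%N -> coef (fps_mul f g) m = (fps_trunc n f * fps_trunc n g)`_m.
Proof.
move=> mn; rewrite coefM /=; apply: eq_bigr => i _.
by rewrite !coef_poly !ltnS !(leq_trans _ mn) ?leq_subr // -ltnS.
Qed.

Fact fps_mulC : commutative fps_mul.
Proof.
by move=> f g; apply: fpsP => n; rewrite !(@coef_fps_mul n) // mulrC.
Qed.

Lemma fps_trunc_mul n f g m : (m <= n)%N ->
  (fps_trunc n (fps_mul f g))`_m = (fps_trunc n f * fps_trunc n g)`_m.
Proof. by move=> mn; rewrite coef_poly ltnS mn (@coef_fps_mul n). Qed.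

Fact fps_mulA : associative fps_mul.
Proof.
move=> f g h; apply: fpsP => n; rewrite !(@coef_fps_mul n) //.
transitivity ((fps_trunc n f * (fps_trunc n g * fps_trunc n h))`_n).
  rewrite !coefM; apply: eq_bigr => i _; congr (_ * _).
  by rewrite fps_trunc_mul ?leq_subr.
rewrite mulrA !coefM; apply: eq_bigr => i _; congr (_ * _).
by rewrite fps_trunc_mul // -ltnS.
Qed.

Fact fps_mul1 : left_id (fps_const 1) fps_mul.
Proof.
move=> f; apply: fpsP => n /=; rewrite big_ord_recl /= subn0 mul1r.
by rewrite big1 ?addr0 // => i _; rewrite mul0r.
Qed.

Fact fps_mulDl : left_distributive fps_mul fps_add.
Proof.
move=> f g h; apply: fpsP => n /=; rewrite -big_split /=.
by apply: eq_bigr => i _; rewrite mulrDl.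
Qed.

Fact fps_one_neq0 : fps_const 1 != 0.
Proof.
by apply/eqP => /(congr1 (fun f => coef f 0)) /= /eqP; rewrite oner_eq0.
Qed.

HB.instance Definition _ := GRing.Zmodule_isComNzRing.Build (fps R)
  fps_mulA fps_mulC fps_mul1 fps_mulDl fps_one_neq0.

Definition fps_unit : pred (fps R) := fun f => `[< exists g, g * f = 1 >].
Definition fps_inv f : fps R :=
  if pselect (exists g, g * f = 1) is left fU then projT1 (cid fU) else f.

Fact fps_mulV : {in fps_unit, left_inverse 1 fps_inv *%R}.
Proof.
move=> f /asboolP fU; rewrite /fps_inv; case: pselect => // e.
by case: (cid e).
Qed.
Fact fps_unitP f g : g * f = 1 -> fps_unit f.
Proof. by move=> gf; apply/asboolP; exists g. Qed.
Fact fps_inv_out : {in [predC fps_unit], fps_inv =1 id}.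
Proof.
by move=> f /asboolP fU; rewrite /fps_inv; case: pselect => // /fU.
Qed.

HB.instance Definition _ := GRing.ComNzRing_hasMulInverse.Build (fps R)
  fps_mulV fps_unitP fps_inv_out.

Definition fps_X : fps R := Fps (fun n => (n == 1%N)%:R).
Definition fps_deriv f : fps R := Fps (fun n => coef f n.+1 *+ n.+1).
Definition fps_poly (p : {poly R}) : fps R := Fps (fun n => p`_n).

End FpsRing.

Section FpsIdomain.
Variable R : idomainType.

Lemma fps_order_ex (f : fps R) : f != 0 ->
  exists2 m, coef f m != 0 & forall i, (i < m)%N -> coef f i = 0.
Proof.
move=> f0; have exf : exists n, coef f n != 0.
  apply: contrapT => nex; move/eqP: f0; apply; apply: fpsP => n /=.
  by apply/eqP/negP => /negP fn; apply: nex; exists n.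
case: (ex_minnP exf) => m fm mmin; exists m => // i im.
by apply/eqP/negP => /negP /mmin; rewrite leqNgt im.
Qed.

Fact fps_idomain : GRing.integral_domain_axiom (fps R).
Proof.
move=> f g fg0; apply/norP => -[/fps_order_ex[m fm ltm] /fps_order_ex[n gn ltn]].
have /eqP := congr1 (fun f => coef f (m + n)%N) fg0.
apply/negP => /=; have mP : (m < (m + n).+1)%N by rewrite ltnS leq_addr.
rewrite (bigD1 (Ordinal mP)) //= addKn big1 ?addr0 ?mulf_neq0 // => i im.
have [lt_im|lt_mi|/eqP eq_im] := ltngtP i m; first by rewrite ltm ?mul0r.
  by rewrite ltn ?mulr0 // ltn_subLR ?ltn_add2r // -ltnS.
by move: im; rewrite -val_eqE /= eq_im.
Qed.

HB.instance Definition _ :=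
  GRing.ComUnitRing_isIntegral.Build (fps R) fps_idomain.

End FpsIdomain.

Section DInfinity.

Local Notation "x %:F" := (FracField.tofrac x).

Definition lspan (E : fieldType) (K V : set E) : set E :=
  [set v | exists n (c s : 'I_n -> E),
     [/\ forall i, K (c i), forall i, V (s i) & v = \sum_(i < n) c i * s i]].

(* Here V is a K-subspace of E. *)
Definition finite_dim (E : fieldType) (K V : set E) : Prop :=
  exists e : seq E, V = lspan K [set` e].

Variables (B : idomainType) (n : nat) (d : 'I_n -> B -> B).

Definition Frac (R : set B) : set {fraction B} :=
  [set q | exists a b, [/\ R a, R b, b != 0 & q = a%:F / b%:F]].

Definition partials (f : B) : set B :=
  range (fun w : seq 'I_n => foldr d f w).

Definition D (R : set B) : set B :=
  [set f | finite_dim (Frac R) (lspan (Frac R) [set g%:F | g in partials f])].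

Definition Dinf (R : set B) : set B := \bigcup_j iter j.+1 D R.

End DInfinity.

Section PowerSeriesXY.
Variable k : fieldType.

Definition kx : set (fps k) := range (@fps_poly k).

Definition kxy : set (fps (fps k)) :=
  range (fun p : {poly {poly k}} => Fps (fun j => fps_poly p`_j)).

Definition d_x (F : fps (fps k)) := Fps (fun j => fps_deriv (coef F j)).
Definition d_y (F : fps (fps k)) := fps_deriv F.

Definition Dinf_x : set (fps k) := Dinf (fun _ : 'I_1 => @fps_deriv k) kx.

Definition Dinf_xy : set (fps (fps k)) :=
  Dinf (fun i : 'I_2 => if i == ord0 then d_x else d_y) kxy.

Definition at_x0 (F : fps (fps k)) : fps k := Fps (fun j => coef (coef F j) 0).

Definition has_order (f : fps k) (e : nat) :=
  coef f e != 0 /\ forall i, (i < e)%N -> coef f i = 0.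

(* [h i] is the coefficient h_{i+1} of y^(e-i-1). *)
Definition weierstrass_poly (e : nat) (h : 'I_e -> fps k) : fps (fps k) :=
  fps_X (fps k) ^+ e + \sum_(i < e) fps_const (h i) * fps_X (fps k) ^+ (e - i.+1).

Definition admits_weierstrass_preparation
    (Axy : set (fps (fps k))) (Ax : set (fps k)) : Prop :=
  forall F e, Axy F -> has_order (at_x0 F) e ->
  exists u (h : 'I_e -> fps k),
    [/\ Axy u, coef (coef u 0) 0 != 0,
        forall i, Ax (h i) /\ coef (h i) 0 = 0
      & F = u * weierstrass_poly h].

End PowerSeriesXY.

Section LocalRings.
Variable A : comNzRingType.
Implicit Types (I J P m : set A).

Definition is_ideal I : Prop :=
  [/\ I 0, forall a b, I a -> I b -> I (a + b) & forall a b, I b -> I (a * b)].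

Definition ideal_gen (s : seq A) : set A :=
  [set a | exists c : 'I_(size s) -> A, a = \sum_(i < size s) c i * s`_i].

Definition noetherian : Prop :=
  forall I, is_ideal I -> exists s, I = ideal_gen s.

Definition prime_ideal P : Prop :=
  [/\ is_ideal P, ~ P 1 & forall a b, P (a * b) -> P a \/ P b].

Definition maximal_ideal m : Prop :=
  [/\ is_ideal m, ~ m 1 & forall J, is_ideal J -> m `<=` J -> ~ J 1 -> J = m].

Definition local : Prop := exists! m, maximal_ideal m.

Definition prime_chain (l : nat) (P : nat -> set A) : Prop :=
  (forall i, (i <= l)%N -> prime_ideal (P i)) /\
  (forall i, (i < l)%N -> P i `<` P i.+1).

Definition krull_dim (l : nat) : Prop :=
  (exists P : nat -> set A, prime_chain l P) /\
  (forall l' (P : nat -> set A), prime_chain l' P -> (l' <= l)%N).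

Definition regular_local : Prop :=
  [/\ noetherian, local
    & forall m, maximal_ideal m ->
      exists s : seq A, m = ideal_gen s /\ krull_dim (size s)].

Definition henselian_local : Prop :=
  local /\
  forall m, maximal_ideal m ->
  forall (p : {poly A}) (a : A), p \is monic -> m p.[a] -> ~ m p^`().[a] ->
  exists b, p.[b] = 0 /\ m (b - a).

End LocalRings.

(* Main.v *)
(** Every element of k[[x, y]] that is algebraic over A = D^oo(k[x, y]) lies in A,
    since its derivatives stay in a finite extension of Frac R for some level R of
    the tower.  Hence A is closed under division in k[[x, y]] and inherits Hensel's
    lemma from k[[x, y]].  Moreover F(x, 0) lies in A whenever F does, so each ideal
    of A is finitely generated: its elements are divided successively by elements
    whose restriction to y = 0 has least order in x, and the quotients add up to a
    power series which is again in A.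

    Preparation fails for F = g(y) - x with g' = 1/Phi(1 + y) and
    Phi(h) = h^2 + h^3.  It would provide a solution h in D^oo(k[x]) of h' = Phi(h).
    Such an h is transcendental over every level R of the tower, by induction:
    suppose that h is algebraic over D(R).  The Taylor expansions
    a(x + s) = sum_m a^(m)(x) s^m/m! of the finitely many coefficients a involved are
    combinations of finitely many functions of x with coefficients in Frac(R)[[s]].
    Enlarging Frac R to a field L over which h is still transcendental, but these
    functions are algebraic over L(h), one finds that T = h(x + s) is algebraic over
    L((s))(h).  Now T is the flow of the vector field Phi d/dh at time s, so h may
    be treated as an indeterminate q; this contradicts the transcendence of the
    exponential function, since log (1 + 1/T) - 1/T = s + log (1 + 1/q) - 1/q. *)

(* The shape of [Phi] comes from the final contradiction. If [Phi] had degree at most 2, the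
   equation would be linear or Riccati: its flow would be a Moebius transformation of the initial
   value with coefficients in k[[s]], and [T] would be rational over L((s))(q). The cubic with a
   double zero at 0 and a simple zero at -1 gives 1/(h^2 (1 + h)) = 1/h^2 - 1/h + 1/(1 + h), whose
   primitive log (1 + 1/h) - 1/h mixes a logarithm with a rational function. The series in s are
   constants for d/dq, so an algebraic relation between [T] and [q] would tie an element to its
   exponential over the constants. The initial value 1 stays away from the zeros of [Phi], and
   Phi(1) = 2 is nonzero in characteristic 0.

   What is propagated down the tower is algebraicity, not membership, because one step of the
   descent returns only an algebraic relation over the lower level. The descent passes below k[x],
   which lies in D(k), and ends at the constants: there an algebraic h has h' = 0, against h'(0) =
   2. *)
From HB Require Import structures.
Require Import Defs.
From mathcomp Require Import all_boot all_order all_algebra.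
From mathcomp Require Import polyXY fraction boolp classical_sets.
From mathcomp Require Import ring zify.

Set Implicit Arguments.
Unset Strict Implicit.
Unset Printing Implicit Defensive.

Import GRing.Theory.
Local Open Scope classical_set_scope.
Local Open Scope ring_scope.

(** * Formal power series *)

Section FpsCoef.
Variable R : comNzRingType.
Implicit Types f g : fps R.

Lemma fps_coef1 n : coef (1 : fps R) n = (n == 0%N)%:R.
Proof. by rewrite /=; case: eqP. Qed.
Lemma fps_coefD f g n : coef (f + g) n = coef f n + coef g n. Proof. by []. Qed.
Lemma fps_coefN f n : coef (- f) n = - coef f n. Proof. by []. Qed.
Lemma fps_coefB f g n : coef (f - g) n = coef f n - coef g n. Proof. by []. Qed.
Lemma fps_coefM f g n :
  coef (f * g) n = \sum_(i < n.+1) coef f i * coef g (n - i).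
Proof. by []. Qed.

Definition fps_nth n f := coef f n.
Lemma fps_nth_is_zmod_morphism n : zmod_morphism (fps_nth n).
Proof. by []. Qed.
HB.instance Definition _ n :=
  GRing.isZmodMorphism.Build (fps R) R (fps_nth n) (fps_nth_is_zmod_morphism n).

Lemma fps_coef_sum I (r : seq I) (P : pred I) (F : I -> fps R) n :
  coef (\sum_(i <- r | P i) F i) n = \sum_(i <- r | P i) coef (F i) n.
Proof. exact: (raddf_sum (fps_nth n)). Qed.

Lemma fps_coefMn f m n : coef (f *+ m) n = coef f n *+ m.
Proof. exact: (raddfMn (fps_nth n)). Qed.

Lemma fps_coefCM f c n : coef (fps_const c * f) n = c * coef f n.
Proof.
rewrite fps_coefM big_ord_recl /= subn0 big1 ?addr0 // => i _.
by rewrite mul0r.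
Qed.

Lemma fps_coef0M f g : coef (f * g) 0 = coef f 0 * coef g 0.
Proof. by rewrite fps_coefM big_ord1. Qed.

Lemma fps_coefXM f n : coef (fps_X R * f) n = if n is n'.+1 then coef f n' else 0.
Proof.
rewrite fps_coefM; case: n => [|n]; first by rewrite big_ord1 /= mul0r.
rewrite big_ord_recl /= mul0r add0r big_ord_recl /= mul1r subSS subn0.
by rewrite big1 ?addr0 // => i _; rewrite mul0r.
Qed.

Lemma fps_const_is_zmod_morphism : zmod_morphism (@fps_const R).
Proof.
by move=> a b; apply: fpsP => n /=; case: eqP => // _; rewrite subr0.
Qed.
Lemma fps_const_is_monoid_morphism : monoid_morphism (@fps_const R).
Proof.
split=> // a b; apply: fpsP => n; rewrite fps_coefCM /=.
by case: eqP => // _; rewrite mulr0.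
Qed.
HB.instance Definition _ :=
  GRing.isZmodMorphism.Build R (fps R) (@fps_const R) fps_const_is_zmod_morphism.
HB.instance Definition _ :=
  GRing.isMonoidMorphism.Build R (fps R) (@fps_const R)
    fps_const_is_monoid_morphism.

Lemma fps_const_inj : injective (@fps_const R).
Proof. by move=> a b /(congr1 (fun f => coef f 0)). Qed.

Definition fps_coef0 f := coef f 0.
Lemma fps_coef0_is_zmod_morphism : zmod_morphism fps_coef0.
Proof. by []. Qed.
Lemma fps_coef0_is_monoid_morphism : monoid_morphism fps_coef0.
Proof. by split=> // f g; rewrite /fps_coef0 fps_coef0M. Qed.
HB.instance Definition _ :=
  GRing.isZmodMorphism.Build (fps R) R fps_coef0 fps_coef0_is_zmod_morphism.
HB.instance Definition _ :=
  GRing.isMonoidMorphism.Build (fps R) R fps_coef0 fps_coef0_is_monoid_morphism.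

Lemma fps_poly_is_zmod_morphism : zmod_morphism (@fps_poly R).
Proof. by move=> p q; apply: fpsP => n /=; rewrite coefB. Qed.
Lemma fps_poly_is_monoid_morphism : monoid_morphism (@fps_poly R).
Proof.
split=> [|p q]; apply: fpsP => n; first by rewrite fps_coef1 [LHS]coef1.
by rewrite fps_coefM /= coefM.
Qed.
HB.instance Definition _ := GRing.isZmodMorphism.Build {poly R} (fps R)
  (@fps_poly R) fps_poly_is_zmod_morphism.
HB.instance Definition _ := GRing.isMonoidMorphism.Build {poly R} (fps R)
  (@fps_poly R) fps_poly_is_monoid_morphism.

Lemma fps_polyC (c : R) : fps_poly c%:P = fps_const c.
Proof. by apply: fpsP => n; rewrite [LHS]coefC. Qed.
Lemma fps_polyX : fps_poly 'X = fps_X R.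
Proof. by apply: fpsP => n /=; rewrite coefX. Qed.
Lemma fps_poly_deriv (p : {poly R}) : fps_poly p^`() = fps_deriv (fps_poly p).
Proof. by apply: fpsP => n /=; rewrite coef_deriv. Qed.

Definition fps_divX f : fps R := Fps (fun n => coef f n.+1).
Lemma fps_divXK f : f = fps_const (coef f 0) + fps_X R * fps_divX f.
Proof.
apply: fpsP => -[|n]; rewrite fps_coefD fps_coefXM /= ?addr0 //.
by rewrite add0r.
Qed.

End FpsCoef.

Section FpsMap.
Variables (R S : comNzRingType).

Definition fps_map (rho : R -> S) (f : fps R) : fps S :=
  Fps (fun n => rho (coef f n)).

Lemma coef_fps_map rho f n : coef (fps_map rho f) n = rho (coef f n).
Proof. by []. Qed.

Variable rho : {rmorphism R -> S}.

Lemma fps_map_is_zmod_morphism : zmod_morphism (fps_map rho).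
Proof. by move=> f g; apply: fpsP => n /=; rewrite rmorphB. Qed.
Lemma fps_map_is_monoid_morphism : monoid_morphism (fps_map rho).
Proof.
split=> [|f g]; apply: fpsP => n; first by rewrite coef_fps_map !fps_coef1 rmorph_nat.
by rewrite /= rmorph_sum; apply: eq_bigr => i _; rewrite rmorphM.
Qed.
HB.instance Definition _ := GRing.isZmodMorphism.Build (fps R) (fps S)
  (fps_map rho) fps_map_is_zmod_morphism.
HB.instance Definition _ := GRing.isMonoidMorphism.Build (fps R) (fps S)
  (fps_map rho) fps_map_is_monoid_morphism.

Lemma fps_map_const c : fps_map rho (fps_const c) = fps_const (rho c).
Proof. by apply: fpsP => n /=; case: eqP => // _; rewrite rmorph0. Qed.

Lemma fps_map_deriv f : fps_map rho (fps_deriv f) = fps_deriv (fps_map rho f).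
Proof. by apply: fpsP => n /=; rewrite rmorphMn. Qed.

End FpsMap.

Definition derivation (R : pzRingType) (d : R -> R) : Prop :=
  (forall a b, d (a + b) = d a + d b) /\ (forall a b, d (a * b) = d a * b + a * d b).

Section Derivation.
Variables (R : comNzRingType) (d : R -> R).
Hypothesis dd : derivation d.

Lemma derD a b : d (a + b) = d a + d b. Proof. exact: dd.1. Qed.
Lemma derM a b : d (a * b) = d a * b + a * d b. Proof. exact: dd.2. Qed.
Lemma der0 : d 0 = 0. Proof. by apply: (addrI (d 0)); rewrite -derD !addr0. Qed.
Lemma derN a : d (- a) = - d a.
Proof. by apply/eqP; rewrite -addr_eq0 -derD addNr der0. Qed.
Lemma derB a b : d (a - b) = d a - d b. Proof. by rewrite derD derN. Qed.
Lemma der1 : d 1 = 0.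
Proof. by apply: (addrI (d 1)); rewrite addr0 -[in RHS](mulr1 1) derM mulr1 mul1r. Qed.
Lemma derMn a n : d (a *+ n) = d a *+ n.
Proof. by elim: n => [|n IH]; rewrite ?mulr0n ?der0 // !mulrS derD IH. Qed.
Lemma der_sum I (r : seq I) (P : pred I) (F : I -> R) :
  d (\sum_(i <- r | P i) F i) = \sum_(i <- r | P i) d (F i).
Proof. by apply: (big_morph d derD der0). Qed.
Lemma derXn a n : d (a ^+ n) = (a ^+ n.-1 * d a) *+ n.
Proof.
elim: n => [|n IH]; first by rewrite expr0 der1 mulr0n.
rewrite exprS derM IH mulrS /= [d a * _]mulrC; congr (_ + _).
by case: n {IH} => [|n]; rewrite ?mulr0n ?mulr0 // mulrnAr exprS mulrA.
Qed.

Lemma der_horner (p : {poly R}) a :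
  d p.[a] = (\poly_(i < size p) d p`_i).[a] + p^`().[a] * d a.
Proof.
rewrite horner_coef der_sum horner_poly.
have -> : p^`().[a] * d a = \sum_(i < size p) p`_i * d (a ^+ i).
  rewrite -[in p^`()](coefK p) poly_def linear_sum /= horner_sum mulr_suml.
  apply: eq_bigr => i _.
  rewrite derivZ derivXn hornerZ hornerMn hornerXn derXn.
  by rewrite -mulrA; congr (_ * _); rewrite mulrnAl.
by rewrite -big_split /=; apply: eq_bigr => i _; rewrite derM.
Qed.

End Derivation.

Lemma fps_deriv_derivation (R : comNzRingType) : derivation (@fps_deriv R).
Proof.
split=> f g; apply: fpsP => n; first by rewrite /= mulrnDl.
rewrite fps_coefD.
(* truncation reduces the identity to the Leibniz rule for polynomials *)
have E (p q : {poly R}) m : (forall i, (i <= m)%N -> p`_i = q`_i) -> forall r : {poly R},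
    (p * r)`_m = (q * r)`_m.
  by move=> pq r; rewrite !coefM; apply: eq_bigr => i _; rewrite pq // -ltnS.
have trE (h : fps R) i : (i <= n)%N ->
    (fps_trunc n (fps_deriv h))`_i = (fps_trunc n.+1 h)^`()`_i.
  by move=> i_n; rewrite coef_deriv !coef_poly !ltnS i_n.
have trS (h : fps R) i : (i <= n)%N -> (fps_trunc n h)`_i = (fps_trunc n.+1 h)`_i.
  by move=> i_n; rewrite !coef_poly !ltnS i_n leqW.
have -> : coef (fps_deriv (f * g)) n =
    (fps_trunc n.+1 f * fps_trunc n.+1 g)`_n.+1 *+ n.+1.
  by rewrite -(@coef_fps_mul _ n.+1).
have -> : coef (fps_deriv f * g) n = (fps_trunc n (fps_deriv f) * fps_trunc n g)`_n.
  by rewrite -(@coef_fps_mul _ n).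
have -> : coef (f * fps_deriv g) n = (fps_trunc n f * fps_trunc n (fps_deriv g))`_n.
  by rewrite -(@coef_fps_mul _ n).
rewrite -coef_deriv derivM coefD; congr (_ + _).
  rewrite (E _ _ _ (trE f)) [in LHS]mulrC [in RHS]mulrC; apply/esym/E => i i_n.
  exact: trS.
rewrite (E _ _ _ (trS f)) [in LHS]mulrC [in RHS]mulrC; apply/esym/E => i i_n.
exact: trE.
Qed.

Lemma fps_map_derivation (R : comNzRingType) (d : R -> R) :
  derivation d -> derivation (fps_map d).
Proof.
move=> dd; split=> f g; apply: fpsP => n /=; first exact: derD.
rewrite (der_sum dd) -big_split /=; apply: eq_bigr => i _; exact: derM.
Qed.

(** * X-adic order, limits and Hensel's lemma *)

Section Order.
Variable R : comNzRingType.
Implicit Types f g h : fps R.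

(** Divisibility by X^n, so that [ordge n (f - g)] expresses X-adic closeness of [f] and [g]. *)
Definition ordge n f := forall i, (i < n)%N -> coef f i = 0.

Lemma ordge_add n f g : ordge n f -> ordge n g -> ordge n (f + g).
Proof. by move=> fn gn i i_n; rewrite fps_coefD fn ?gn ?addr0. Qed.
Lemma ordge_opp n f : ordge n f -> ordge n (- f).
Proof. by move=> fn i i_n; rewrite fps_coefN fn ?oppr0. Qed.
Lemma ordge_sub n f g : ordge n f -> ordge n g -> ordge n (f - g).
Proof. by move=> fn gn; apply/ordge_add/ordge_opp. Qed.
Lemma ordge_mul m n f g : ordge m f -> ordge n g -> ordge (m + n) (f * g).
Proof.
move=> fm gn i i_mn; rewrite fps_coefM big1 // => j _.
have [jm|mj] := ltnP j m; first by rewrite fm ?mul0r.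
by rewrite gn ?mulr0 // ltn_subLR ?(leq_trans i_mn) ?leq_add2r // -ltnS.
Qed.
Lemma ordge_mulr n f g : ordge n f -> ordge n (f * g).
Proof. by move=> fn; rewrite -[n]addn0; apply: ordge_mul. Qed.
Lemma ordge_leq m n f : (m <= n)%N -> ordge n f -> ordge m f.
Proof. by move=> mn fn i im; apply/fn/(leq_trans im). Qed.
Lemma ordge_eq0 f : (forall n, ordge n f) -> f = 0.
Proof. by move=> fn; apply: fpsP => n; apply: (fn n.+1). Qed.
Lemma ordge1 f : coef f 0 = 0 -> ordge 1 f.
Proof. by move=> f0 [|i]. Qed.

Lemma fps_coefXnM f n i :
  coef (fps_X R ^+ n * f) i = if (i < n)%N then 0 else coef f (i - n).
Proof.
elim: n i => [|n IH] i; first by rewrite expr0 mul1r subn0.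
by rewrite exprS -mulrA fps_coefXM; case: i => // i; rewrite IH ltnS subSS.
Qed.

Lemma ordge_mulXn n f : ordge n (fps_X R ^+ n * f).
Proof. by move=> i i_n; rewrite fps_coefXnM i_n. Qed.

Definition fps_shift n f := Fps (fun i => coef f (n + i)).
Lemma ordgeE n f : ordge n f -> f = fps_X R ^+ n * fps_shift n f.
Proof.
move=> fn; apply: fpsP => i; rewrite fps_coefXnM.
by case: ltnP => [/fn//|ni] /=; rewrite subnKC.
Qed.

(** Completeness: coefficient n no longer changes after step n + 1, so the diagonal is the limit. *)
Lemma ordge_limit (b : nat -> fps R) :
    (forall n, ordge n (b n.+1 - b n)) ->
  exists c, forall n, ordge n (c - b n).
Proof.
move=> bS; exists (Fps (fun n => coef (b n.+1) n)) => n i i_n.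
rewrite fps_coefB /=; apply/eqP; rewrite subr_eq0 eq_sym; apply/eqP.
rewrite -(subnKC i_n); elim: (n - i.+1)%N => [|m IH]; first by rewrite addn0.
rewrite -IH addnS; apply/eqP; rewrite -subr_eq0 -fps_coefB bS //.
by rewrite addSn ltnS leq_addr.
Qed.

End Order.

Lemma horner_taylor2 (R : comNzRingType) (p : {poly R}) (x y : R) :
  exists q, p.[x + y] = p.[x] + p^`().[x] * y + y ^+ 2 * q.
Proof.
elim/poly_ind: p => [|p c [q IH]].
  by exists 0; rewrite deriv0 !horner0 mul0r mulr0 !addr0.
exists (q * (x + y) + p^`().[x]).
rewrite derivD derivC addr0 derivM derivX !hornerE IH; ring.
Qed.

(* Newton iteration with the derivative frozen at the residue of the root. *)
Lemma hensel (R : comUnitRingType) (p : {poly fps R}) (a : R) :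
    root (map_poly (@fps_coef0 R) p) a ->
    (map_poly (@fps_coef0 R) p)^`().[a] \is a GRing.unit ->
  exists2 b, root p b & coef b 0 = a.
Proof.
set p0 := map_poly _ p; set u := p0^`().[a] => /rootP pa uU.
have hornerE0 (q : {poly fps R}) b :
    coef q.[b] 0 = (map_poly (@fps_coef0 R) q).[coef b 0].
  exact: esym (horner_map (@fps_coef0 R) q b).
pose b := fix b n := if n is m.+1 then b m - fps_const u^-1 * p.[b m]
                     else fps_const a.
have bS n : b n.+1 = b n - fps_const u^-1 * p.[b n] by [].
have bP n : coef (b n) 0 = a /\ ordge n.+1 p.[b n].
  elim: n => [|n [bn0 pn]].
    by split=> //; apply: ordge1; rewrite hornerE0.
  rewrite bS; split.
    by rewrite fps_coefB fps_coefCM pn // mulr0 subr0.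
  have [q ->] := horner_taylor2 p (b n) (- (fps_const u^-1 * p.[b n])).
  rewrite mulrN mulrA -{1}[p.[b n]]mul1r -mulrBl sqrrN; apply: ordge_add.
    rewrite -[n.+2]/(1 + n.+1)%N; apply: ordge_mul pn; apply: ordge1.
    by rewrite fps_coefB fps_coef0M hornerE0 bn0 -deriv_map fps_coef1 /= mulrV ?subrr.
  apply: ordge_mulr; apply: (@ordge_leq _ _ (n.+1 + n.+1)); first by lia.
  by apply: ordge_mul; rewrite mulrC; apply: ordge_mulr.
have [c cb] : exists c, forall n, ordge n (c - b n).
  apply: ordge_limit => n; rewrite bS addrC addKr; apply: ordge_opp.
  by rewrite mulrC; apply: ordge_mulr; apply: ordge_leq (bP n).2.
exists c; last first.
  have := cb 1%N 0%N isT; rewrite fps_coefB (bP 1%N).1 => /eqP.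
  by rewrite subr_eq0 => /eqP.
apply/rootP/ordge_eq0 => n.
have [q] := horner_taylor2 p (b n) (c - b n); rewrite addrC subrK => ->.
rewrite -addrA; apply: ordge_add; first by apply: ordge_leq (bP n).2.
rewrite mulrC expr2 -mulrA -mulrDr; exact: ordge_mulr.
Qed.

(** Hensel's lemma for the linear polynomial f X - 1. *)
Lemma fps_unit_coef0 (R : comUnitRingType) (f : fps R) :
  coef f 0 \is a GRing.unit -> exists g, f * g = 1.
Proof.
move=> fU; pose p : {poly fps R} := f *: 'X - 1.
have pE : map_poly (@fps_coef0 R) p = coef f 0 *: 'X - 1.
  by rewrite rmorphB /= map_polyZ map_polyX rmorph1.
have [||g /rootP] := @hensel R p (coef f 0)^-1.
- by rewrite pE rootE !hornerE mulrV ?subrr.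
- by rewrite pE !derivE !hornerE subr0.
by rewrite /p !hornerE => /eqP; rewrite subr_eq0 => /eqP; exists g.
Qed.

Lemma fps_order (R : fieldType) (f : fps R) : f != 0 ->
  exists n u, f = fps_X R ^+ n * u /\ coef u 0 != 0.
Proof.
move=> /fps_order_ex [n fn0 fn]; exists n, (fps_shift n f).
by split; [apply: ordgeE | rewrite /= addn0].
Qed.

(** * Algebraic elements over subfields given as sets *)

(** Subrings and subfields are sets in a fixed ambient ring, so that extensions are compared by
    inclusion and no embeddings have to be carried along. *)
Definition subring_set (R : comNzRingType) (S : set R) : Prop :=
  [/\ S 1, forall a b, S a -> S b -> S (a - b)
    & forall a b, S a -> S b -> S (a * b)].

Definition subfield_set (E : fieldType) (S : set E) : Prop :=
  subring_set S /\ forall a, S a -> S a^-1.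

Definition poly_in (R : nzRingType) (S : set R) (p : {poly R}) : Prop :=
  forall i, S p`_i.

Definition poly2_in (R : nzRingType) (S : set R) (P : {poly {poly R}}) : Prop :=
  forall i, poly_in S P`_i.

Definition alg (R : comNzRingType) (S : set R) (u : R) : Prop :=
  exists p : {poly R}, [/\ poly_in S p, p != 0 & root p u].

Section SubringSet.
Variables (R : comNzRingType) (S : set R).
Hypothesis HS : subring_set S.

Lemma subring1 : S 1. Proof. by case: HS. Qed.
Lemma subringB a b : S a -> S b -> S (a - b). Proof. by case: HS => _ H _; apply: H. Qed.
Lemma subringM a b : S a -> S b -> S (a * b). Proof. by case: HS => _ _; apply. Qed.
Lemma subring0 : S 0. Proof. by rewrite -(subrr 1); apply: subringB; apply: subring1. Qed.
Lemma subringN a : S a -> S (- a).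
Proof. by rewrite -sub0r => Sa; apply: subringB => //; apply: subring0. Qed.
Lemma subringD a b : S a -> S b -> S (a + b).
Proof. by move=> Sa Sb; rewrite -[b]opprK; apply/subringB/subringN. Qed.
Lemma subring_sum I (r : seq I) (P : pred I) (F : I -> R) :
  (forall i, P i -> S (F i)) -> S (\sum_(i <- r | P i) F i).
Proof. by move=> SF; apply: big_ind => //; [apply: subring0 | apply: subringD]. Qed.
Lemma subringX a n : S a -> S (a ^+ n).
Proof.
by move=> Sa; elim: n => [|n IH]; rewrite ?expr0 ?exprS;
  [apply: subring1 | apply: subringM].
Qed.
Lemma subringMn a n : S a -> S (a *+ n).
Proof.
by move=> Sa; elim: n => [|n IH]; rewrite ?mulrS; [apply: subring0 | apply: subringD].
Qed.
Lemma subring_nat n : S n%:R. Proof. by apply: subringMn; apply: subring1. Qed.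
Lemma subring_horner p a : poly_in S p -> S a -> S p.[a].
Proof.
move=> Sp Sa; rewrite horner_coef; apply: subring_sum => i _.
by apply: subringM => //; apply: subringX.
Qed.

Lemma poly_in_subring : subring_set (poly_in S).
Proof.
split=> [i|p q Sp Sq i|p q Sp Sq i].
- by rewrite coef1; case: (i == 0%N); [apply: subring1 | apply: subring0].
- by rewrite coefB; apply: subringB.
- by rewrite coefM; apply: subring_sum => j _; apply: subringM.
Qed.
Lemma poly_inC c : S c -> poly_in S c%:P.
Proof. by move=> Sc i; rewrite coefC; case: ifP => // _; apply: subring0. Qed.
Lemma poly_inX : poly_in S 'X.
Proof. by move=> i; rewrite coefX; apply: subring_nat. Qed.
Lemma poly_in_deriv p : poly_in S p -> poly_in S p^`().
Proof. by move=> Sp i; rewrite coef_deriv; apply: subringMn. Qed.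
End SubringSet.

Lemma alg_id (R : comNzRingType) (S : set R) u : subring_set S -> S u -> alg S u.
Proof.
move=> HS Su; exists ('X - u%:P); split; rewrite ?polyXsubC_eq0 ?root_XsubC //.
by apply: (subringB (poly_in_subring HS)); [apply: poly_inX | apply: poly_inC].
Qed.

Lemma subfieldV (E : fieldType) (S : set E) a : subfield_set S -> S a -> S a^-1.
Proof. by case=> _; apply. Qed.

Lemma subfieldF (E : fieldType) (S : set E) a b : subfield_set S -> S a -> S b -> S (a / b).
Proof. by move=> HS Sa Sb; apply: (subringM HS.1) => //; apply: subfieldV. Qed.

Lemma poly_in_sub (R : nzRingType) (S T : set R) p :
  S `<=` T -> poly_in S p -> poly_in T p.
Proof. by move=> ST Sp i; apply: ST. Qed.

Lemma alg_sub (R : comNzRingType) (S T : set R) : S `<=` T -> alg S `<=` alg T.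
Proof.
by move=> ST u [p [Sp p0 pu]]; exists p; split=> //; apply: poly_in_sub Sp.
Qed.

Section SubfieldType.
Variables (E : fieldType) (S : set E).
Hypothesis HS : subfield_set S.

(** The proof of [subfield_set S] is an argument of the predicate so that the closedness instance
    can be attached to it. *)
Definition mem_subfield of subfield_set S : {pred E} := fun x => `[< S x >].

Fact mem_subfield_closed : divring_closed (mem_subfield HS).
Proof.
split=> [|a b /asboolP Sa /asboolP Sb|a b /asboolP Sa /asboolP Sb]; apply/asboolP.
- exact: (subring1 HS.1).
- exact: (subringB HS.1).
- exact: subfieldF.
Qed.
HB.instance Definition _ :=
  GRing.isDivringClosed.Build E (mem_subfield HS) mem_subfield_closed.

Record subfield_type :=
  SubfieldType { subfield_val : E; _ : subfield_val \in mem_subfield HS }.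
HB.instance Definition _ := [isSub for subfield_val].
HB.instance Definition _ := [Choice of subfield_type by <:].
HB.instance Definition _ := [SubChoice_isSubIntegralDomain of subfield_type by <:].
HB.instance Definition _ := [SubIntegralDomain_isSubField of subfield_type by <:].

Lemma subfield_valP (x : subfield_type) : S (val x).
Proof. exact/asboolP/(valP x). Qed.

Lemma subfield_lift a : S a -> exists x : subfield_type, val x = a.
Proof.
by move=> Sa; have aS : a \in mem_subfield HS by [apply/asboolP]; exists (SubfieldType aS).
Qed.

Lemma poly_in_lift p : poly_in S p ->
  exists q : {poly subfield_type}, p = map_poly val q.
Proof.
move=> Sp; have [c cE] := choice (fun i => subfield_lift (Sp i)).
exists (\poly_(i < size p) c i); apply/polyP => i.
rewrite coef_map coef_poly; case: ltnP => [_|/(nth_default 0) ->].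
  exact/esym/cE.
by rewrite raddf0.
Qed.

Lemma poly_in_map_val (q : {poly subfield_type}) : poly_in S (map_poly val q).
Proof. by move=> i; rewrite coef_map; apply: subfield_valP. Qed.

(** Bridge to the algebraicity of the library, from which closure under the field operations and
    transitivity are inherited. *)
Lemma algP u : alg S u <-> algebraicOver (val : subfield_type -> E) u.
Proof.
split=> [[p [/poly_in_lift [q ->]]]|[q q0 qu]].
  by rewrite map_poly_eq0 => q0 qu; exists q.
exists (map_poly val q); rewrite map_poly_eq0; split=> //.
exact: poly_in_map_val.
Qed.

Lemma alg_subfield : subfield_set (alg S).
Proof.
split; last by move=> a /algP Sa; apply/algP/algebraic_inv.
split; first by apply/algP/algebraic1.
  by move=> a b /algP Sa /algP Sb; apply/algP/algebraic_sub.
by move=> a b /algP Sa /algP Sb; apply/algP/algebraic_mul.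
Qed.

Lemma alg_trans : alg (alg S) `<=` alg S.
Proof.
move=> u [p [Sp p0 pu]]; apply/algP/integral_algebraic.
apply: (integral_root p0 pu) => _ /(nthP 0) [i _ <-].
exact/integral_algebraic/algP.
Qed.

End SubfieldType.

Section Fracs.
Variables (E : fieldType) (S : set E).
Hypothesis HS : subring_set S.

Definition fracs : set E := [set q | exists a b, [/\ S a, S b, b != 0 & q = a / b]].

Lemma fracs_id : S `<=` fracs.
Proof.
by move=> a Sa; exists a, 1; rewrite oner_neq0 divr1; split=> //; apply: subring1.
Qed.

Lemma fracs_subfield : subfield_set fracs.
Proof.
split; last first.
  move=> _ [a [b [Sa Sb b0 ->]]]; have [->|a0] := eqVneq a 0.
    by rewrite mul0r invr0; apply/fracs_id/(subring0 HS).
  by exists b, a; rewrite invf_div.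
split; first by apply/fracs_id/(subring1 HS).
  move=> _ _ [a [b [Sa Sb b0 ->]]] [c [d [Sc Sd d0 ->]]].
  exists (a * d - c * b), (b * d); rewrite mulf_neq0 //; split=> //.
  - by apply: (subringB HS); apply: subringM.
  - exact: subringM.
  - by rewrite -mulNr addf_div // mulNr.
move=> _ _ [a [b [Sa Sb b0 ->]]] [c [d [Sc Sd d0 ->]]].
by exists (a * c), (b * d); rewrite mulf_neq0 // mulf_div; split=> //; apply: subringM.
Qed.

Lemma common_denom n (c : nat -> E) : (forall i, (i < n)%N -> fracs (c i)) ->
  exists d, [/\ S d, d != 0 & forall i, (i < n)%N -> S (d * c i)].
Proof.
elim: n => [|n IH] Fc.
  by exists 1; rewrite oner_neq0; split=> //; apply: subring1.
have [i i_n|d [Sd d0 dc]] := IH; first by apply: Fc; apply: ltnW.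
have [a [b [Sa Sb b0 cE]]] := Fc n (ltnSn n).
exists (d * b); split; [exact: subringM | exact: mulf_neq0 |].
move=> i; rewrite ltnS leq_eqVlt => /predU1P [->|i_n].
  by rewrite cE -mulrA [b * _]mulrC divfK //; apply: subringM.
by rewrite mulrAC; apply: subringM => //; apply: dc.
Qed.

Lemma fracs_alg : alg fracs `<=` alg S.
Proof.
move=> u [p [Sp p0 pu]]; have [d [Sd d0 dp]] := @common_denom (size p) _ (fun i _ => Sp i).
exists (d *: p); split; last by rewrite rootE hornerZ (rootP pu) mulr0.
  move=> i; rewrite coefZ; have [/dp//|/(nth_default 0) ->] := ltnP i (size p).
  by rewrite mulr0; apply: subring0.
by rewrite scaler_eq0 negb_or d0.
Qed.

End Fracs.

Lemma fracs_sub (E : fieldType) (S T : set E) : S `<=` T -> fracs S `<=` fracs T.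
Proof.
move=> ST _ [a [b [Sa Sb b0 ->]]]; exists a, b.
by split=> //; apply: ST.
Qed.

Lemma fracs_le (E : fieldType) (S T : set E) : subfield_set T ->
  S `<=` T -> fracs S `<=` T.
Proof. by move=> HT ST _ [a [b [Sa Sb b0 ->]]]; apply: subfieldF => //; apply: ST. Qed.

Section Adjoin.
Variables (E : fieldType) (S : set E).
Hypothesis HS : subring_set S.

Definition polyset (v : E) : set E := [set a | exists2 p, poly_in S p & a = p.[v]].
Definition adj (v : E) : set E := fracs (polyset v).

Lemma polyset_subring v : subring_set (polyset v).
Proof.
have HP := poly_in_subring HS.
split; first by exists 1; rewrite ?hornerC //; apply: (subring1 HP).
  move=> _ _ [p Sp ->] [q Sq ->]; exists (p - q); last by rewrite !hornerE.
  exact: (subringB HP).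
move=> _ _ [p Sp ->] [q Sq ->]; exists (p * q); last by rewrite !hornerE.
exact: (subringM HP).
Qed.

Lemma adj_subfield v : subfield_set (adj v).
Proof. exact/fracs_subfield/polyset_subring. Qed.

Lemma adj_base v : S `<=` adj v.
Proof.
move=> a Sa; apply: (fracs_id (polyset_subring v)); exists a%:P.
  exact: poly_inC.
by rewrite hornerC.
Qed.

Lemma adj_gen v : adj v v.
Proof.
apply: (fracs_id (polyset_subring v)); exists 'X; last by rewrite hornerX.
exact: poly_inX.
Qed.

Lemma adj_le (T : set E) v : subfield_set T -> S `<=` T -> T v -> adj v `<=` T.
Proof.
move=> HT ST Tv; apply: fracs_le => // _ [p Sp ->].
by apply: (subring_horner HT.1) => //; apply: poly_in_sub Sp.
Qed.

(** Clear denominators, then lift each coefficient from S[v] to a polynomial. In [P.[u, v]] the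
    outer variable becomes [u] and the inner one [v]. *)
Lemma alg_adj u v : alg (adj v) u ->
  exists P, [/\ poly2_in S P, P != 0 & P.[u, v] = 0].
Proof.
move=> /(fracs_alg (polyset_subring v)) [p [Sp p0 pu]].
have [c cP] := choice (fun i => let: ex_intro2 q Sq qE := Sp i in
   ex_intro (fun q => poly_in S q /\ p`_i = q.[v]) q (conj Sq qE)).
have cE : map_poly (horner_eval v) (\poly_(i < size p) c i) = p.
  apply/polyP => i; rewrite coef_map coef_poly.
  case: ltnP => [_|/(nth_default 0) ->]; last by rewrite raddf0.
  by rewrite /= /horner_eval (cP i).2.
exists (\poly_(i < size p) c i); split.
- move=> i; rewrite coef_poly; case: ltnP => _; first exact: (cP i).1.
  by apply: (subring0 (poly_in_subring HS)).
- by apply: contraNneq p0 => P0; rewrite -cE P0 raddf0.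
- by rewrite -horner2_swapXY horner_swapXY cE; apply/rootP.
Qed.

(** Transcendence of [v] keeps the leading coefficient of [P] nonzero when the inner variable
    becomes [v]. *)
Lemma adj_alg u v (P : {poly {poly E}}) : ~ alg S v ->
  poly2_in S P -> P != 0 -> P.[u, v] = 0 -> alg (adj v) u.
Proof.
move=> Sv SP P0 Puv; exists (map_poly (horner_eval v) P); split.
- move=> i; rewrite coef_map /=; apply: (fracs_id (polyset_subring v)).
  by exists P`_i.
- apply: contra_notN Sv => /eqP PE; have PE' i : (P`_i).[v] = 0.
    by rewrite -/(horner_eval v P`_i) -coef_map PE coef0.
  exists (lead_coef P); split; [exact: SP | by rewrite lead_coef_eq0 |].
  by apply/rootP/PE'.
- rewrite rootE; apply/eqP.
  by rewrite -Puv -horner2_swapXY horner_swapXY.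
Qed.

(** Steinitz exchange: the relation between [u] and [v], read with its two variables swapped. *)
Lemma alg_exchange u v : alg (adj v) u -> ~ alg S u -> alg (adj u) v.
Proof.
move=> /alg_adj [P [SP P0 Puv]] Su.
apply: (adj_alg (P := swapXY P)) => //; last 1 first.
- by rewrite horner2_swapXY.
- by move=> i j; rewrite coef_swapXY; apply: SP.
- by rewrite swapXY_eq0.
Qed.

End Adjoin.

Lemma adj_sub (E : fieldType) (S T : set E) v : S `<=` T -> adj S v `<=` adj T v.
Proof.
move=> ST; apply: fracs_sub => _ [p Sp ->]; exists p => //.
exact: poly_in_sub Sp.
Qed.

(** * Linear spans over subfields given as sets *)

Section Span.
Variables (E : fieldType) (K : set E).
Hypothesis HK : subfield_set K.
Implicit Types (V W : set E) (e : seq E).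

Definition subspace_set W : Prop :=
  [/\ W 0, forall u v, W u -> W v -> W (u + v)
    & forall c v, K c -> W v -> W (c * v)].

Lemma subspace_sum W I (r : seq I) (P : pred I) (F : I -> E) :
  subspace_set W -> (forall i, P i -> W (F i)) -> W (\sum_(i <- r | P i) F i).
Proof. by case=> W0 WD _ WF; apply: big_ind. Qed.

Lemma subspaceB W u v : subspace_set W -> W u -> W v -> W (u - v).
Proof.
case=> _ WD WZ Wu Wv; apply: WD => //; rewrite -mulN1r.
by apply: WZ => //; apply/(subringN HK.1)/(subring1 HK.1).
Qed.

Lemma lspan_le V W : subspace_set W -> V `<=` W -> lspan K V `<=` W.
Proof.
move=> HW VW _ [n [c [s [Kc Vs ->]]]]; apply: subspace_sum => // i _.
by case: HW => _ _ WZ; apply: WZ => //; apply: VW.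
Qed.

Lemma lspan_gen V : V `<=` lspan K V.
Proof.
move=> v Vv; exists 1%N, (fun=> 1), (fun=> v).
by split=> // [_|]; [apply: (subring1 HK.1) | rewrite big_ord1 mul1r].
Qed.

Lemma lspan_subspace V : subspace_set (lspan K V).
Proof.
split.
- exists 0%N, (fun=> 0), (fun=> 0).
  by split=> [[]//|[]//|]; rewrite big_ord0.
- move=> _ _ [n [c [s [Kc Vs ->]]]] [m [c' [s' [Kc' Vs' ->]]]].
  exists (n + m)%N, (fun i => match split i with inl j => c j | inr j => c' j end),
    (fun i => match split i with inl j => s j | inr j => s' j end).
  split=> [i|i|]; try by case: (split i).
  rewrite big_split_ord /=; congr (_ + _); apply: eq_bigr => i _.
    case: splitP => j /= ij; last by have := ltn_ord i; rewrite ij; lia.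
    by have -> : i = j by apply: val_inj.
  case: splitP => j /= ij; first by have := ltn_ord j; rewrite -ij; lia.
  by have -> : i = j by apply: val_inj => /=; lia.
- move=> a _ Ka [n [c [s [Kc Vs ->]]]]; exists n, (fun i => a * c i), s.
  split=> // [i|]; first exact: (subringM HK.1).
  by rewrite mulr_sumr; apply: eq_bigr => i _; rewrite mulrA.
Qed.

Lemma lspan_sub V W : V `<=` W -> lspan K V `<=` lspan K W.
Proof.
move=> VW; apply: lspan_le; first exact: lspan_subspace.
by move=> v /VW; apply: lspan_gen.
Qed.

Lemma lspan_cons x e v : lspan K [set` x :: e] v ->
  exists c w, [/\ K c, lspan K [set` e] w & v = c * x + w].
Proof.
have [S0 SD SZ] := lspan_subspace [set` e].
move: v; apply: lspan_le.
  split.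
  - by exists 0, 0; split; rewrite ?mul0r ?addr0 //; apply: (subring0 HK.1).
  - move=> _ _ [c [w [Kc Sw ->]]] [c' [w' [Kc' Sw' ->]]].
    exists (c + c'), (w + w'); split; [exact: (subringD HK.1) | exact: SD |].
    by rewrite mulrDl addrACA.
  - move=> a _ Ka [c [w [Kc Sw ->]]]; exists (a * c), (a * w).
    by split; [exact: (subringM HK.1) | exact: SZ | rewrite mulrDr mulrA].
move=> v /=; rewrite inE => /predU1P [->|ve].
  by exists 1, 0; rewrite mul1r addr0; split=> //; apply: (subring1 HK.1).
exists 0, v; rewrite mul0r add0r; split=> //; first exact: (subring0 HK.1).
exact: lspan_gen.
Qed.

Lemma lspan_nil v : lspan K [set` [::]] v -> v = 0.
Proof.
apply: (lspan_le (W := [set 0])) => //; split=> //.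
  by move=> _ _ -> ->; rewrite addr0.
by move=> c _ _ ->; rewrite mulr0.
Qed.

Lemma lspan_seqP e v : lspan K [set` e] v ->
  exists c : nat -> E, (forall i, K (c i)) /\ v = \sum_(i < size e) c i * e`_i.
Proof.
elim: e v => [|x e IH] v.
  move=> /lspan_nil ->; exists (fun=> 0); split=> [_|]; first exact: (subring0 HK.1).
  by rewrite big_ord0.
move=> /lspan_cons [a [w [Ka /IH [c [Kc ->]] ->]]].
exists (fun i => if i is j.+1 then c j else a); split=> [[|i]//|].
by rewrite big_ord_recl.
Qed.

(** Induction on [e], looking at the coefficient of the head [x]: a vector of [W] where it is
    nonzero, if there is one, completes a spanning family of the part of [W] inside the span of the
    tail. *)
Lemma finite_dim_sub W e : subspace_set W -> W `<=` lspan K [set` e] ->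
  exists e', W = lspan K [set` e'].
Proof.
elim: e W => [|x e IH] W HW We.
  exists [::]; apply/seteqP; split=> v //; first exact: We.
  by move=> /lspan_nil ->; case: HW.
have He := lspan_subspace [set` e].
have [||e' e'E] := IH (W `&` lspan K [set` e]); last 1 first.
- have [[c [w [Kc c0 Sw Ww]]]|nex] := pselect (exists c w,
      [/\ K c, c != 0, lspan K [set` e] w & W (c * x + w)]).
    exists ((c * x + w) :: e'); apply/seteqP; split=> v; last first.
      apply: lspan_le => // u /=; rewrite inE => /predU1P [->//|ue'].
      by have [] : (W `&` lspan K [set` e]) u by rewrite e'E; apply: lspan_gen.
    move=> Wv; have [c1 [v' [Kc1 Sv' vE]]] := lspan_cons (We _ Wv).
    have [S0 SD SZ] := lspan_subspace [set` c * x + w :: e'].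
    rewrite -[v](subrK ((c1 / c) * (c * x + w))); apply: SD; last first.
      apply: SZ; first exact: subfieldF.
      by apply: lspan_gen; rewrite /= inE eqxx.
    apply: (@lspan_sub [set` e']); first by move=> u ue'; rewrite /= inE ue' orbT.
    rewrite -e'E; split.
      apply: subspaceB => //; case: HW => _ _ WZ; apply: WZ => //; exact: subfieldF.
    rewrite vE mulrDr mulrA divfK // opprD addrACA subrr add0r.
    by apply: subspaceB => //; case: He => _ _; apply=> //; apply: subfieldF.
  exists e'; rewrite -e'E; apply/seteqP; split=> v; last by case.
  move=> Wv; split=> //; have [c [w [Kc Sw vE]]] := lspan_cons (We _ Wv).
  have [c0|c0] := eqVneq c 0; first by rewrite vE c0 mul0r add0r.
  by case: nex; exists c, w; rewrite -vE.
- case: HW He => W0 WD WZ [S0 SD SZ]; split=> //.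
    by move=> u v [? ?] [? ?]; split; [apply: WD | apply: SD].
  by move=> c v Kc [? ?]; split; [apply: WZ | apply: SZ].
- by move=> v [].
Qed.

(** The coordinate matrix has more rows than columns, hence a nonzero left kernel. *)
Lemma lspan_dep e m (v : nat -> E) : (size e < m)%N ->
    (forall i, (i < m)%N -> lspan K [set` e] (v i)) ->
  exists c : nat -> E, [/\ forall i, K (c i), exists2 i, (i < m)%N & c i != 0
    & \sum_(i < m) c i * v i = 0].
Proof.
move=> em ve.
have [M ME] : exists M : 'M[subfield_type HK]_(m, size e),
    forall i : 'I_m, v i = \sum_(j < size e) val (M i j) * e`_j.
  have rowE (i : 'I_m) : exists c : 'I_(size e) -> subfield_type HK,
      v i = \sum_(j < size e) val (c j) * e`_j.
    have [c [Kc ->]] := lspan_seqP (ve i (ltn_ord i)).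
    have [c' c'E] := choice (fun j => subfield_lift HK (Kc j)).
    by exists (fun j => c' j); apply: eq_bigr => j _; congr (_ * _); apply/esym/c'E.
  have [c cE] := choice rowE.
  by exists (\matrix_(i, j) c i j) => i; rewrite cE; apply: eq_bigr => j _; rewrite mxE.
have : kermx M != 0.
  by rewrite kermx_eq0 /row_free neq_ltn (leq_ltn_trans (rank_leq_col M) em).
move=> /rowV0Pn [u /sub_kermxP uM u0].
have insE (j : 'I_m) : insub (nat_of_ord j) = Some j by exact: valK.
exists (fun i => if insub i is Some j then val (u 0 j) else 0); split.
- by move=> i; case: insubP => [j _ _|_]; [apply: subfield_valP | apply: (subring0 HK.1)].
- have [j uj] := rV0Pn _ u0; exists (nat_of_ord j) => //.
  by rewrite insE fmorph_eq0.
- under eq_bigr => i _ do rewrite insE ME mulr_sumr.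
  rewrite exchange_big big1 // => j _.
  under eq_bigr => i _ do rewrite mulrA.
  rewrite -mulr_suml.
  have /(congr1 (fun x : subfield_type HK => val x)) : (u *m M) 0 j = 0.
    by rewrite uM mxE.
  rewrite mxE rmorph_sum rmorph0 => uMj.
  by rewrite (eq_bigr (fun i => val (u 0 i * M i j))) ?uMj ?mul0r.
Qed.

End Span.

(** * The operators D and Dinf *)

Local Notation "x %:F" := (FracField.tofrac x).

Lemma tofrac_inj (B : idomainType) : injective (@FracField.tofrac B).
Proof. by move=> a b /eqP; rewrite tofrac_eq => /eqP. Qed.

Definition frac_image (B : idomainType) (R : set B) : set {fraction B} :=
  [set a%:F | a in R].

Definition frac_seq (B : idomainType) (e : seq B) : seq {fraction B} :=
  [seq a%:F | a <- e].

Lemma frac_image_subring (B : idomainType) (R : set B) :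
  subring_set R -> subring_set (frac_image R).
Proof.
case=> R1 RB RM; split; first by exists 1; rewrite ?rmorph1.
  by move=> _ _ [a Ra <-] [b Rb <-]; exists (a - b); rewrite ?rmorphB //; apply: RB.
by move=> _ _ [a Ra <-] [b Rb <-]; exists (a * b); rewrite ?rmorphM //; apply: RM.
Qed.

Lemma FracE (B : idomainType) (R : set B) : Frac R = fracs (frac_image R).
Proof.
apply/seteqP; split=> q.
  move=> [a [b [Ra Rb b0 ->]]]; exists a%:F, b%:F; split=> //.
  - by exists a.
  - by exists b.
  - by rewrite tofrac_eq0.
move=> [_ [_ [[a Ra <-] [b Rb <-] b0 ->]]]; exists a, b; split=> //.
by rewrite tofrac_eq0 in b0.
Qed.

Lemma poly_in_image (B C : comNzRingType) (f : {rmorphism B -> C}) (R : set B) p :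
    poly_in [set f a | a in R] p -> R 0 ->
  exists2 q, poly_in R q & p = map_poly f q.
Proof.
move=> Rp R0; have [c cP] := choice (fun i => let: ex_intro2 a Ra aE := Rp i in
   ex_intro (fun a => R a /\ f a = p`_i) a (conj Ra aE)).
exists (\poly_(i < size p) c i).
  by move=> i; rewrite coef_poly; case: ifP => // _; apply: (cP i).1.
apply/polyP => i; rewrite coef_map coef_poly; case: ltnP => [_|/(nth_default 0) ->].
  by rewrite /= (cP i).2.
by rewrite raddf0.
Qed.

Lemma alg_frac (B : idomainType) (R : set B) u : subring_set R ->
  alg (Frac R) u%:F <-> alg R u.
Proof.
move=> HR; split; last first.
  move=> [p [Rp p0 pu]]; exists (map_poly (@FracField.tofrac B) p); split.
  - move=> i; rewrite FracE coef_map; apply: fracs_id; last by exists p`_i.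
    exact: frac_image_subring.
  - rewrite -size_poly_eq0 size_map_inj_poly ?size_poly_eq0 ?rmorph0 //.
    exact: tofrac_inj.
  - by rewrite rootE horner_map (rootP pu) rmorph0.
rewrite FracE => /(fracs_alg (frac_image_subring HR)) [p [Rp p0 pu]].
have [q Rq pE] := poly_in_image Rp (subring0 HR).
exists q; split=> //; first by apply: contraNneq p0; rewrite pE => ->; rewrite rmorph0.
by move: pu; rewrite pE !rootE horner_map tofrac_eq0.
Qed.

(* The polynomial of least degree over K vanishing at t makes K[t] a field,
   by Bezout. *)
Section MinimalPolynomial.
Variables (E : fieldType) (K : set E) (t : E) (p : {poly E}).
Hypotheses (HK : subfield_set K) (Kp : poly_in K p) (p0 : p != 0) (pt : root p t).
Hypothesis pmin :
  forall q, poly_in K q -> q != 0 -> root q t -> (size p <= size q)%N.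

Lemma polyset_inv a : polyset K t a -> polyset K t a^-1.
Proof.
move=> [r Kr ->]; have [->|rt] := eqVneq r.[t] 0.
  by rewrite invr0; apply: (subring0 (polyset_subring HK.1 t)).
have [P PE] := poly_in_lift HK Kp; have [r' rE] := poly_in_lift HK Kr.
have P0 : P != 0 by apply: contraNneq p0; rewrite PE => ->; rewrite rmorph0.
pose ev (s : {poly subfield_type HK}) := (map_poly val s).[t].
have evM s1 s2 : ev (s1 * s2) = ev s1 * ev s2 by rewrite /ev rmorphM hornerM.
have evP : ev P = 0 by rewrite /ev -PE; apply/rootP.
(* Write P = m g with g the gcd. As g divides r', it does not vanish at t, so m does; minimality of
   P then leaves only a constant g. *)
have : coprimep P r'.
  rewrite /coprimep; set g := gcdp P r'.
  have /dvdpP [m mE] : (g %| P)%R by apply: dvdp_gcdl.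
  have m0 : m != 0 by apply: contraNneq P0; rewrite mE => ->; rewrite mul0r.
  have g0 : g != 0 by apply: contraNneq P0; rewrite mE => ->; rewrite mulr0.
  have : ev m * ev g == 0 by rewrite -evM -mE evP.
  rewrite mulf_eq0 => /orP [/eqP em|/eqP eg]; last first.
    have /dvdpP [s sE] : (g %| r')%R by apply: dvdp_gcdr.
    by move: rt; rewrite rE -/(ev r') sE evM eg mulr0 eqxx.
  have := pmin (poly_in_map_val m); rewrite map_poly_eq0 PE !size_map_poly.
  rewrite mE size_mul // => /(_ m0); rewrite rootE -/(ev m) em eqxx => /(_ isT).
  by move: m0 g0; rewrite -!size_poly_gt0; move: (size m) (size g) => i j; lia.
move=> /Bezout_coprimepP [[u v] /= uv1].
have /eqpP [[c1 c2] /= /andP [c10 c20] cE] := uv1.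
have evZ c (s : {poly subfield_type HK}) : ev (c *: s) = val c * ev s.
  by rewrite /ev map_polyZ hornerZ.
have := congr1 ev cE; rewrite !evZ.
have -> : ev (u * P + v * r') = ev v * ev r'.
  by rewrite {1}/ev rmorphD hornerD -!/(ev _) !evM evP mulr0 add0r.
have -> : ev 1 = 1 by rewrite /ev rmorph1 hornerC.
rewrite mulr1 => eE; exists (map_poly val (c2^-1 * c1 *: v)).
  exact: poly_in_map_val.
rewrite -/(ev _) evZ rmorphM fmorphV /= -/(ev r').
have r'0 : ev r' != 0 by rewrite /ev -rE.
apply: (mulIf r'0); rewrite rE mulVf -?/(ev r') //.
by rewrite -!mulrA eE mulVf // fmorph_eq0.
Qed.

Lemma polyset_span : polyset K t `<=` lspan K [set` [seq t ^+ i | i <- iota 0 (size p)]].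
Proof.
move=> _ [r Kr ->].
have [P PE] := poly_in_lift HK Kp; have [r' rE] := poly_in_lift HK Kr.
have P0 : P != 0 by apply: contraNneq p0; rewrite PE => ->; rewrite rmorph0.
have -> : r.[t] = (map_poly val (r' %% P)).[t].
  rewrite rE {1}(divp_eq r' P) rmorphD rmorphM hornerD hornerM /= -PE.
  by rewrite (rootP pt) mulr0 add0r.
rewrite horner_coef; apply: subspace_sum; first exact: lspan_subspace.
move=> i _; have [_ _ SZ] := lspan_subspace HK [set` [seq t ^+ i | i <- iota 0 (size p)]].
apply: (SZ); first exact: poly_in_map_val.
apply: (lspan_gen HK); apply/mapP; exists (nat_of_ord i) => //.
rewrite mem_iota /= add0n; apply: leq_trans (ltn_ord i) _.
by rewrite size_map_poly PE size_map_poly ltnW // ltn_modp.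
Qed.

End MinimalPolynomial.

Section DTheory.
Variables (B : idomainType) (n : nat) (d : 'I_n -> B -> B).
Hypothesis dd : forall i, derivation (d i).
Implicit Types (R : set B) (f g u : B).

Definition diffring_set R : Prop := subring_set R /\ forall i a, R a -> R (d i a).

Lemma partials_refl f : partials d f f. Proof. by exists [::]. Qed.
Lemma partials_d f g i : partials d f g -> partials d f (d i g).
Proof. by move=> [w _ <-]; exists (i :: w). Qed.
Lemma partials_ind (Z : set B) f : Z f -> (forall i g, Z g -> Z (d i g)) ->
  partials d f `<=` Z.
Proof. by move=> Zf Zd _ [w _ <-]; elim: w => //= i w; apply: Zd. Qed.

Section Fixed.
Variable R : set B.
Hypothesis HR : diffring_set R.

Lemma Frac_subfield : subfield_set (Frac R).
Proof. by rewrite FracE; apply/fracs_subfield/frac_image_subring/HR.1. Qed.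

Lemma Frac_id f : R f -> Frac R f%:F.
Proof.
move=> Rf; rewrite FracE; apply: fracs_id; last by exists f.
by apply/frac_image_subring/HR.1.
Qed.

Let HK := Frac_subfield.

(** By [finite_dim_sub] the partials need only lie inside some finitely generated space. *)
Lemma D_intro f (e : seq {fraction B}) :
    (forall g, partials d f g -> lspan (Frac R) [set` e] g%:F) ->
  D d R f.
Proof.
move=> fe; apply: (finite_dim_sub HK (e := e)); first exact: lspan_subspace.
by apply: lspan_le => //; [apply: lspan_subspace | move=> _ [g fg <-]; apply: fe].
Qed.

Lemma D_elim f : D d R f ->
  exists e : seq {fraction B}, forall g, partials d f g -> lspan (Frac R) [set` e] g%:F.
Proof.
move=> [e eE]; exists e => g fg; rewrite -eE; apply: lspan_gen => //.
by exists g.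
Qed.

(** The derivations act on [B] and not on its fraction field, so a linear combination must be
    cleared of denominators before it is differentiated. *)
Lemma lspan_clear_denom e g : lspan (Frac R) [set` frac_seq e] g%:F ->
  exists b (a : nat -> B), [/\ R b, b != 0, forall i, R (a i)
    & b * g = \sum_(i < size e) a i * e`_i].
Proof.
move=> /(lspan_seqP HK) [c [Kc]]; rewrite size_map => gE.
have Kc' i : (i < size e)%N -> fracs (frac_image R) (c i) by rewrite -FracE.
have [_ [[b Rb <-] b0 bc]] := common_denom (frac_image_subring HR.1) Kc'.
have aP i : exists a, R a /\ ((i < size e)%N -> a%:F = b%:F * c i).
  case: (ltnP i (size e)) => [/bc [a Ra aE]|_]; first by exists a.
  by exists 0; split=> //; apply: (subring0 HR.1).
have [a {}aP] := choice aP; exists b, a; split=> //.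
- by move: b0; rewrite tofrac_eq0.
- by move=> i; case: (aP i).
apply: tofrac_inj; rewrite rmorphM /= gE mulr_sumr rmorph_sum.
apply: eq_bigr => i _; rewrite rmorphM /= (aP i).2 // mulrA.
by rewrite (nth_map 0).
Qed.

(** Working criterion for membership: by the Leibniz rule, stability on the generators extends to
    the whole span, which then absorbs every partial of [f]. *)
Lemma D_stable f e :
    (forall i x, x \in e -> lspan (Frac R) [set` frac_seq e] (d i x)%:F) ->
    lspan (Frac R) [set` frac_seq e] f%:F ->
  D d R f.
Proof.
move=> de fe; apply: (D_intro (e := frac_seq e)) => g; move: g.
apply: (partials_ind (Z := [set g | lspan (Frac R) [set` frac_seq e] g%:F])) => //.
move=> i g /= ge; have [b [a [Rb b0 Ra bg]]] := lspan_clear_denom ge.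
have He := lspan_subspace HK [set` frac_seq e]; have [_ _ SZ] := He.
have b0' : b%:F != 0 by rewrite tofrac_eq0.
(* The derivative of b g = sum of a_j e_j, solved for the derivative of g. *)
have -> : (d i g)%:F =
    (b%:F)^-1 * (\sum_(j < size e) ((d i (a j))%:F * (e`_j)%:F + (a j)%:F * (d i (e`_j))%:F)
                 - (d i b)%:F * g%:F).
  apply: (mulfI b0'); rewrite mulVKf // -!rmorphM.
  rewrite (eq_bigr (fun j : 'I_(size e) => (d i (a j * e`_j))%:F)); last first.
    by move=> j _; rewrite -!rmorphM -rmorphD -(derM (dd i)).
  rewrite -rmorph_sum -(der_sum (dd i)) -bg -rmorphB (derM (dd i)).
  by congr (_%:F); rewrite addrC addKr.
apply: (SZ); first by apply: (subfieldV HK); apply: Frac_id.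
apply: (subspaceB HK) => //; last by apply: (SZ) => //; apply/Frac_id/HR.2.
apply: (subspace_sum _ He) => j _; have [_ SD _] := He; apply: (SD).
  apply: (SZ); first by apply/Frac_id/HR.2.
  by apply: (lspan_gen HK); apply/mapP; exists e`_j => //; apply: mem_nth.
by apply: (SZ); [apply: Frac_id | apply/de/mem_nth].
Qed.

Lemma sub_D : R `<=` D d R.
Proof.
move=> f Rf; apply: (@D_stable f [:: 1]) => [i x|].
  rewrite inE => /eqP ->; rewrite (der1 (dd i)) rmorph0.
  by case: (lspan_subspace HK [set` frac_seq [:: 1]]).
have [_ _ SZ] := lspan_subspace HK [set` frac_seq [:: 1]].
rewrite -[f]mulr1 rmorphM; apply: (SZ); first exact: Frac_id.
by apply: (lspan_gen HK); rewrite /= inE.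
Qed.

Lemma D_diffring : diffring_set (D d R).
Proof.
split; last first.
  move=> i f /D_elim [e eP]; apply: (D_intro (e := e)) => g fg.
  apply: eP; apply: partials_ind fg; first by apply/partials_d/partials_refl.
  by move=> j h; apply: partials_d.
split; first by apply: sub_D; apply: (subring1 HR.1).
  move=> f g /D_elim [ef fP] /D_elim [eg gP]; apply: (D_intro (e := ef ++ eg)).
  have Hs := lspan_subspace HK [set` ef ++ eg].
  have -> : partials d (f - g) = [set h | exists w, h = foldr d f w - foldr d g w].
    apply/seteqP; split=> [_ [w _ <-]|_ [w ->]].
      exists w; elim: w => //= i w ->; exact: (derB (dd i)).
    exists w => //; elim: w => //= i w ->; exact: (derB (dd i)).
  move=> _ [w ->]; rewrite rmorphB; apply: (subspaceB HK) => //.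
    by apply: (lspan_sub HK _ (fP _ _)); [move=> x /=; rewrite mem_cat => -> | exists w].
  by apply: (lspan_sub HK _ (gP _ _)); [move=> x /=; rewrite mem_cat orbC => -> | exists w].
move=> f g /D_elim [ef fP] /D_elim [eg gP].
pose e := [seq x * y | x <- ef, y <- eg]; apply: (D_intro (e := e)).
have Hs := lspan_subspace HK [set` e]; have [S0 SD SZ] := Hs.
have prodP (a b : B) : partials d f a -> partials d g b ->
    lspan (Frac R) [set` e] (a * b)%:F.
  move=> /fP fa /gP gb; rewrite rmorphM /=.
  move: gb; apply: (lspan_le (W := [set y | lspan (Frac R) [set` e] (a%:F * y)])).
    split=> /= [|u v Su Sv|c v Kc Sv]; first by rewrite mulr0.
      by rewrite mulrDr; apply: (SD).
    by rewrite mulrCA; apply: (SZ).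
  move=> y ey /=; move: fa.
  apply: (lspan_le (W := [set x | lspan (Frac R) [set` e] (x * y)])).
    split=> /= [|u v Su Sv|c v Kc Sv]; first by rewrite mul0r.
      by rewrite mulrDl; apply: (SD).
    by rewrite -mulrA; apply: (SZ).
  by move=> x ex; apply: (lspan_gen HK); apply/allpairsP; exists (x, y).
(* By the Leibniz rule, partials of f g are finite sums of products of a partial of [f] and a
   partial of [g]. *)
pose Z := [set h | exists s : seq (B * B), h = \sum_(p <- s) p.1 * p.2 /\
  forall p, p \in s -> partials d f p.1 /\ partials d g p.2].
suff fgZ : partials d (f * g) `<=` Z.
  move=> _ /fgZ [s [-> sP]]; rewrite rmorph_sum big_seq.
  by apply: (subspace_sum _ Hs) => p /sP [fp gp]; apply: prodP.
apply: partials_ind.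
  exists [:: (f, g)]; rewrite big_seq1; split=> // p; rewrite inE => /eqP ->.
  by split; apply: partials_refl.
move=> i _ [s [-> sP]].
exists ([seq (d i p.1, p.2) | p <- s] ++ [seq (p.1, d i p.2) | p <- s]); split.
  rewrite (der_sum (dd i)) big_cat /= !big_map -big_split /=.
  by apply: eq_bigr => p _; apply: (derM (dd i)).
move=> p; rewrite mem_cat => /orP [] /mapP [q /sP [fq gq] ->] /=;
  by split=> //; apply: partials_d.
Qed.

(* K[u] is a finite-dimensional differential field. *)
Lemma alg_D : (forall m, m.+1%:R != 0 :> B) -> alg R `<=` D d R.
Proof.
move=> char0 u uR.
have exm : exists m,
    `[< exists q : {poly B}, [/\ poly_in R q, q != 0, root q u & size q = m] >].
  by case: uR => q [Rq q0 qu]; exists (size q); apply/asboolP; exists q.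
case: (ex_minnP exm) => N /asboolP [p [Rp p0 pu pN]] Nmin.
have {}Nmin q : poly_in R q -> q != 0 -> root q u -> (size p <= size q)%N.
  by move=> Rq q0 qu; rewrite pN; apply: Nmin; apply/asboolP; exists q.
pose K := Frac R; pose t := u%:F; pose P := map_poly (@FracField.tofrac B) p.
have KP : poly_in K P by move=> i; rewrite coef_map; apply: Frac_id.
have szP : size P = size p.
  by rewrite size_map_inj_poly ?rmorph0 //; apply: tofrac_inj.
have P0 : P != 0 by rewrite -size_poly_eq0 szP size_poly_eq0.
have Pt : root P t by rewrite rootE horner_map (rootP pu) rmorph0.
(* Minimality over [R] passes to the fraction field by clearing denominators. *)
have Pmin q : poly_in K q -> q != 0 -> root q t -> (size P <= size q)%N.
  move=> Kq q0 qt.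
  have Kq' i : (i < size q)%N -> fracs (frac_image R) q`_i.
    by move=> _; rewrite -FracE; apply: Kq.
  have [b [Rb b0 bq]] := common_denom (frac_image_subring HR.1) Kq'.
  have Rbq : poly_in (frac_image R) (b *: q).
    move=> i; rewrite coefZ; have [/bq//|/(nth_default 0) ->] := ltnP i (size q).
    by rewrite mulr0; apply: (subring0 (frac_image_subring HR.1)).
  have [r Rr rE] := poly_in_image Rbq (subring0 HR.1).
  have r0 : r != 0.
    have: b *: q != 0 by rewrite scaler_eq0 negb_or b0.
    by apply: contraNneq; rewrite rE => ->; rewrite rmorph0.
  rewrite szP -(size_scale q b0) rE size_map_inj_poly ?rmorph0 //; last exact: tofrac_inj.
  apply: Nmin => //; have : root (b *: q) t by rewrite rootE hornerZ (rootP qt) mulr0.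
  by rewrite rE !rootE horner_map tofrac_eq0.
have HKt := polyset_subring HK.1 t.
have KtR q : poly_in R q -> polyset K t q.[u]%:F.
  move=> Rq; exists (map_poly (@FracField.tofrac B) q); last by rewrite horner_map.
  by move=> i; rewrite coef_map; apply: Frac_id.
(* In characteristic 0 the derivative of [p] is nonzero, and it has smaller degree, so minimality
   forbids that it vanishes at [u]. *)
have p'u : p^`().[u] != 0.
  have p_gt1 : (1 < size p)%N.
    rewrite ltnNge; apply/negP => /size1_polyC pE; move: pu p0.
    by rewrite pE rootC polyC_eq0 => ->.
  have : ~~ root p^`() u; last by rewrite rootE.
  apply/negP => /Nmin; move=> /(_ (poly_in_deriv HR.1 Rp)).
  have -> : p^`() != 0.
    apply/eqP => /(congr1 (fun q : {poly B} => q`_(size p).-2)).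
    rewrite coef_deriv coef0 -mulr_natr => /eqP; rewrite mulf_eq0 (negPf (char0 _)) orbF.
    rewrite -[(size p).-2.+1]/((size p).-1.-1.+1) prednK;
      last by rewrite -ltnS prednK // ltnW.
    by rewrite -lead_coefE lead_coef_eq0 (negPf p0).
  by move=> /(_ isT); rewrite leqNgt lt_size_deriv.
(* Differentiating p(u) = 0 expresses p'(u) times the derivative of u inside K[t], where p'(u) is
   invertible. *)
have Kdu i : polyset K t (d i u)%:F.
  have := der_horner (dd i) p u; rewrite (rootP pu) (der0 (dd i)) => /esym/eqP.
  rewrite addrC addr_eq0 => /eqP /(congr1 (@FracField.tofrac B)).
  rewrite rmorphM rmorphN /= => duE.
  have p'u' : (p^`().[u])%:F != 0 by rewrite tofrac_eq0.
  rewrite -[X in polyset _ _ X](mulKf p'u') duE; apply: (subringM HKt).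
    apply: (polyset_inv HK KP P0 Pt Pmin); apply: KtR.
    exact: (poly_in_deriv HR.1).
  apply: (subringN HKt); apply: KtR => j; rewrite coef_poly; case: ifP => _.
    exact: HR.2.
  exact: (subring0 HR.1).
have Ktu : polyset K t t by exists 'X; rewrite ?hornerX //; apply: (poly_inX HK.1).
pose e := [seq u ^+ i | i <- iota 0 (size p)].
have eE : frac_seq e = [seq t ^+ i | i <- iota 0 (size P)].
  by rewrite /frac_seq /e -map_comp szP; apply: eq_map => i /=; rewrite rmorphXn.
have Ke : polyset K t `<=` lspan K [set` frac_seq e].
  by rewrite eE; apply: (polyset_span HK KP P0 Pt).
apply: (@D_stable u e); last exact: Ke.
move=> i _ /mapP [j _ ->]; apply: Ke; rewrite (derXn (dd i)) rmorphMn rmorphM rmorphXn.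
apply: (subringMn HKt); apply: (subringM HKt); last exact: Kdu.
by apply: (subringX HKt); apply: Ktu.
Qed.

End Fixed.

Definition Dn R j := iter j (D d) R.

Section Tower.
Variable R : set B.
Hypothesis HR : diffring_set R.

Lemma Dn_diffring j : diffring_set (Dn R j).
Proof. by elim: j => //= j; apply: D_diffring. Qed.

Lemma Dn_mono i j : (i <= j)%N -> Dn R i `<=` Dn R j.
Proof.
move=> ij; rewrite -(subnK ij); elim: (j - i)%N => //= m IH f /IH.
exact: (sub_D (Dn_diffring _)).
Qed.

Lemma Dinf_Dn j : Dn R j `<=` Dinf d R.
Proof. by move=> f /(Dn_mono (leqnSn j)) fj; exists j. Qed.

Lemma Dinf_Dn_ex f : Dinf d R f -> exists j, Dn R j f.
Proof. by move=> [j _ fj]; exists j.+1. Qed.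

Lemma Dinf_common (f : nat -> B) m : (forall i, Dinf d R (f i)) ->
  exists j, forall i, (i < m)%N -> Dn R j (f i).
Proof.
move=> Df; elim: m => [|m [j IH]]; first by exists 0%N.
have [j' fj] := Dinf_Dn_ex (Df m); exists (maxn j j') => i.
rewrite ltnS leq_eqVlt => /predU1P [->|/IH fi].
  by apply: Dn_mono fj; apply: leq_maxr.
by apply: Dn_mono fi; apply: leq_maxl.
Qed.

Lemma Dinf_subring : subring_set (Dinf d R).
Proof.
split; first by apply: (@Dinf_Dn 0); apply: (subring1 HR.1).
all: move=> f g Df Dg; have [|j fg] := @Dinf_common (fun i => if i == 0%N then f else g) 2.
all: try by case=> [|i].
all: have fj := fg 0%N isT; have gj := fg 1%N isT; apply: (@Dinf_Dn j).
  exact: (subringB (Dn_diffring j).1).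
exact: (subringM (Dn_diffring j).1).
Qed.

Lemma Dinf_alg : (forall m, m.+1%:R != 0 :> B) -> alg (Dinf d R) `<=` Dinf d R.
Proof.
move=> char0 u [p [Dp p0 pu]]; have [j pj] := Dinf_common (size p) Dp.
apply: (@Dinf_Dn j.+1); apply: (alg_D (Dn_diffring j)) => //; exists p; split=> // i.
case: (ltnP i (size p)) => [/pj//|/(nth_default 0) ->].
exact: (subring0 (Dn_diffring j).1).
Qed.

End Tower.
End DTheory.

(** * The ring Dinf_xy *)

Lemma fps_char0 (R : comNzRingType) :
  (forall m, m.+1%:R != 0 :> R) -> forall m, m.+1%:R != 0 :> fps R.
Proof.
move=> R0 m; apply: contraNneq (R0 m) => /(congr1 (fun f => coef f 0)).
by rewrite fps_coefMn => ->.
Qed.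

Section PowerSeriesXY.
Variable k : fieldType.

Definition dxy (i : 'I_2) : fps (fps k) -> fps (fps k) :=
  if i == ord0 then @d_x k else @d_y k.

Lemma d_x_derivation : derivation (@d_x k).
Proof. exact/fps_map_derivation/fps_deriv_derivation. Qed.
Lemma d_y_derivation : derivation (@d_y k).
Proof. exact: fps_deriv_derivation. Qed.

Lemma dxy_derivation i : derivation (dxy i).
Proof.
by rewrite /dxy; case: ifP => _; [apply: d_x_derivation | apply: d_y_derivation].
Qed.

Lemma Dinf_xyE : Dinf_xy (k := k) = Dinf dxy (kxy (k := k)).
Proof. by congr Dinf; apply/funext => i; rewrite /dxy; case: ifP. Qed.

Definition poly_xy (p : {poly {poly k}}) : fps (fps k) :=
  fps_map (@fps_poly k) (fps_poly p).

Lemma kxyE : kxy (k := k) = range poly_xy. Proof. by []. Qed.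

Lemma kxy_diffring : diffring_set dxy (kxy (k := k)).
Proof.
rewrite kxyE; split.
  split; first by exists 1; rewrite // /poly_xy !rmorph1.
    by move=> _ _ [p _ <-] [q _ <-]; exists (p - q); rewrite // /poly_xy !rmorphB.
  by move=> _ _ [p _ <-] [q _ <-]; exists (p * q); rewrite // /poly_xy !rmorphM.
move=> i _ [p _ <-]; rewrite /dxy; case: ifP => _.
  exists (map_poly (@deriv k) p) => //; apply: fpsP => j.
  rewrite coef_fps_map [coef (fps_poly _) j]coef_map /= fps_poly_deriv //.
by exists p^`() => //; rewrite /poly_xy fps_poly_deriv fps_map_deriv.
Qed.

Local Notation S := (Dinf dxy (kxy (k := k))).

Lemma Dinf_xy_kxy p : S (poly_xy p).
Proof. by apply: (Dinf_Dn dxy_derivation kxy_diffring (j := 0)); exists p. Qed.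

Lemma Dinf_xy_x : S (fps_const (fps_X k)).
Proof.
have -> : fps_const (fps_X k) = poly_xy 'X%:P.
  by rewrite /poly_xy fps_polyC fps_map_const /= fps_polyX.
exact: Dinf_xy_kxy.
Qed.

Lemma Dinf_xy_y : S (fps_X (fps k)).
Proof.
have -> : fps_X (fps k) = poly_xy 'X.
  rewrite /poly_xy fps_polyX; apply: fpsP => n.
  by rewrite coef_fps_map /= rmorph_nat.
exact: Dinf_xy_kxy.
Qed.

Lemma iter_d_x i c :
  iter i (@d_x k) (fps_const c) = fps_const (iter i (@fps_deriv k) c).
Proof.
elim: i => //= i ->; apply: fpsP => n /=; case: eqP => // _.
by apply: fpsP => j /=; rewrite mul0rn.
Qed.

(** Dividing by the leading coefficient, the x-derivatives of [c] of order below that of the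
    equation span a space stable under [d_x]; [d_y] kills these generators. *)
Lemma linear_ode_D (R : set (fps (fps k))) m (a : nat -> fps (fps k)) c :
    diffring_set dxy R -> (forall i, (i <= m)%N -> R (a i)) ->
    (exists2 i, (i <= m)%N & a i != 0) ->
    \sum_(i < m.+1) a i * fps_const (iter i (@fps_deriv k) c) = 0 ->
  D dxy R (fps_const c).
Proof.
move=> HR Ra [r0 r0m ar0] rel.
(* The equation is cut at the last index whose coefficient is nonzero. *)
wlog am : m Ra r0m rel / a m != 0.
  move=> IH; have exr : exists r, (r <= m)%N && (a r != 0) by exists r0; rewrite r0m.
  have bnd r : (r <= m)%N && (a r != 0) -> (r <= m)%N by case/andP.
  case: (ex_maxnP exr bnd) => r /andP [rm ar] rmax.
  apply: (IH r) => //.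
  - by move=> i ir; apply/Ra/(leq_trans ir).
  - by apply: rmax; rewrite r0m.
  - apply: etrans rel; rewrite -[in RHS](subnKC rm) -addSn big_split_ord /=.
    rewrite [X in _ = _ + X]big1 ?addr0 // => i _.
    have [->|ai] := eqVneq (a (r.+1 + i)%N) 0; first by rewrite mul0r.
    have := rmax (r.+1 + i)%N; rewrite ai andbT.
    by have := ltn_ord i; lia.
pose e := [seq fps_const (iter i (@fps_deriv k) c) | i <- iota 0 m].
have HK := Frac_subfield HR.
have He := lspan_subspace HK [set` frac_seq e].
have eP i : (i <= m)%N ->
    lspan (Frac R) [set` frac_seq e] (fps_const (iter i (@fps_deriv k) c))%:F.
  have lt_e j : (j < m)%N ->
      lspan (Frac R) [set` frac_seq e] (fps_const (iter j (@fps_deriv k) c))%:F.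
    move=> jm; apply: (lspan_gen HK); apply/mapP.
    exists (fps_const (iter j (@fps_deriv k) c)) => //.
    by apply/mapP; exists j; rewrite ?mem_iota.
  rewrite leq_eqVlt => /predU1P [->|]; last exact: lt_e.
  move: rel; rewrite big_ord_recr /= => /eqP; rewrite addrC addr_eq0 => /eqP.
  move=> /(congr1 (@FracField.tofrac _)); rewrite rmorphM rmorphN rmorph_sum /= => mE.
  have am' : (a m)%:F != 0 by rewrite tofrac_eq0.
  rewrite -[X in lspan _ _ X](mulKf am') mE; have [S0 SD SZ] := He.
  apply: (SZ); first by apply/(subfieldV HK)/(Frac_id HR)/Ra.
  rewrite -sub0r; apply: (subspaceB HK He) => //.
  apply: (subspace_sum _ He) => i' _; rewrite rmorphM; apply: (SZ); last exact: lt_e.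
  by apply/(Frac_id HR)/Ra/ltnW.
apply: (D_stable dxy_derivation HR (e := e)); last exact: (eP 0%N).
move=> i x /mapP [j]; rewrite mem_iota add0n => /andP [_ jm] ->; rewrite /dxy.
case: ifP => _.
  by have -> : d_x (fps_const (iter j (@fps_deriv k) c))
    = fps_const (iter j.+1 (@fps_deriv k) c); [rewrite -!iter_d_x | apply: eP].
have -> : d_y (fps_const (iter j (@fps_deriv k) c)) = 0.
  by apply: fpsP => n /=; rewrite mul0rn.
by rewrite rmorph0; case: He.
Qed.

(* The exponent r makes the induction on j go through: the coefficients of the
   linear relation satisfied by F have to be divided by a power of y. *)
Lemma Dn_restrict_y0 j r G : Dn dxy (kxy (k := k)) j (fps_X (fps k) ^+ r * G) ->
  S (fps_const (coef G 0)).
Proof.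
elim: j r G => [|j IH] r G.
  move=> [p _ /(congr1 (fun f => coef f r))]; rewrite fps_coefXnM ltnn subnn => <-.
  by rewrite /= -fps_map_const -fps_polyC; apply: Dinf_xy_kxy.
pose R := Dn dxy (kxy (k := k)) j.
have HR : diffring_set dxy R := Dn_diffring dxy_derivation kxy_diffring j.
rewrite [Dn _ _ _]/= -/R => /(D_elim HR) [e eP].
have HK := Frac_subfield HR.
(* [d_x] treats y^r as a constant, so y^r cancels from any linear relation between these
   partials. *)
have iterP (i : nat) : partials dxy (fps_X (fps k) ^+ r * G)
    (fps_X (fps k) ^+ r * iter i (@d_x k) G).
  exists (nseq i ord0) => //; elim: i => //= i ->.
  have dX : d_x (fps_X (fps k) ^+ r) = 0.
    rewrite (derXn d_x_derivation).
    have -> : d_x (fps_X (fps k)) = 0.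
      apply: fpsP => n /=; apply: fpsP => m /=.
      by case: (n == 1%N); case: m => *; rewrite /= ?mul0rn.
    by rewrite mulr0 mul0rn.
  by rewrite /dxy /= (derM d_x_derivation) dX mul0r add0r.
have [c [Kc [i0 i0m ci0] rel]] := lspan_dep HK (ltnSn (size e)) (fun i _ => eP _ (iterP i)).
have Kc' i : (i < (size e).+1)%N -> fracs (frac_image R) (c i) by rewrite -FracE.
have [b [Rb b0 bc]] := common_denom (frac_image_subring HR.1) Kc'.
have aP i : exists a, (i < (size e).+1)%N -> R a /\ a%:F = b * c i.
  by case: ltnP => [/bc [a Ra aE]|_]; [exists a | exists 0].
have [a {}aP] := choice aP.
have ai0 : a i0 != 0.
  by rewrite -tofrac_eq0 (aP _ i0m).2 mulf_neq0.
have {}rel : \sum_(i < (size e).+1) a i * iter i (@d_x k) G = 0.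
  have Xr0 : fps_X (fps k) ^+ r != 0.
    apply/expf_neq0/eqP => /(congr1 (fun f => coef (coef f 1) 0)) /eqP.
    by rewrite /= oner_eq0.
  apply: (mulfI Xr0); rewrite mulr0; apply: tofrac_inj.
  rewrite rmorph0 -[RHS](mulr0 b) -rel !mulr_sumr rmorph_sum.
  by apply: eq_bigr => i _; rewrite [in LHS]mulrCA rmorphM /= (aP _ (ltn_ord i)).2 mulrA.
(* y^s is the largest power of y dividing all the coefficients; once it is divided out, the relation
   stays nontrivial at y = 0. *)
have [s [a' [aE [i1 i1m ai1]]]] : exists s (a' : nat -> fps (fps k)),
    (forall i, (i < (size e).+1)%N -> a i = fps_X (fps k) ^+ s * a' i) /\
    exists2 i, (i < (size e).+1)%N & coef (a' i) 0 != 0.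
  have exs : exists s, [exists i : 'I_(size e).+1, coef (a i) s != 0].
    have [s as0 _] := fps_order_ex ai0.
    by exists s; apply/existsP; exists (Ordinal i0m).
  case: (ex_minnP exs) => s /existsP [i1 ai1] smin.
  exists s, (fun i => fps_shift s (a i)); split; last first.
    by exists (nat_of_ord i1) => //=; rewrite addn0.
  move=> i im; apply: ordgeE => t ts; apply/eqP; apply: contraTT ts => at0.
  by rewrite -leqNgt; apply: smin; apply/existsP; exists (Ordinal im).
have {}rel : \sum_(i < (size e).+1) fps_const (coef (a' i) 0) *
    fps_const (iter i (@fps_deriv k) (coef G 0)) = 0.
  have : \sum_(i < (size e).+1) a' i * iter i (@d_x k) G = 0.
    have Xs0 : fps_X (fps k) ^+ s != 0.
      apply/expf_neq0/eqP => /(congr1 (fun f => coef (coef f 1) 0)) /eqP.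
      by rewrite /= oner_eq0.
    apply: (mulfI Xs0); rewrite mulr0 mulr_sumr; apply: etrans rel; apply: eq_bigr => i _.
    by rewrite mulrA -aE.
  move=> /(congr1 (fun f => fps_const (coef f 0))).
  rewrite rmorph0 fps_coef_sum rmorph_sum => H; apply: etrans H.
    apply: eq_bigr => i _; rewrite fps_coef0M rmorphM; congr (_ * fps_const _).
  by elim: (nat_of_ord i) => //= i' ->.
have Sa i : (i < (size e).+1)%N -> S (fps_const (coef (a' i) 0)).
  by move=> im; apply: (IH s); rewrite -aE //; apply: (aP i im).1.
(* The induction hypothesis places the coefficients only somewhere in the tower, so a level [m]
   containing all of them is chosen afresh. *)
have [|m am] := Dinf_common dxy_derivation kxy_diffring (f :=
   fun i => if (i < (size e).+1)%N then fps_const (coef (a' i) 0) else 0) (size e).+1.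
  move=> i; case: ifP => [/Sa//|_].
  exact: (subring0 (Dinf_subring dxy_derivation kxy_diffring)).
apply: (Dinf_Dn dxy_derivation kxy_diffring (j := m.+1)).
apply: (linear_ode_D (m := size e) (a := fun i => fps_const (coef (a' i) 0))) => //.
- exact: (Dn_diffring dxy_derivation kxy_diffring).
- by move=> i; rewrite -ltnS => im; have := am i im; rewrite im.
- exists i1 => //; apply: contraNneq ai1 => /(congr1 (fun f => coef f 0)) /= ->.
  by [].
Qed.

Lemma Dinf_xy_restrict F : S F -> S (fps_const (coef F 0)).
Proof.
move=> /Dinf_Dn_ex [j Fj]; apply: (@Dn_restrict_y0 j 0).
by rewrite expr0 mul1r.
Qed.

End PowerSeriesXY.

(** * Regular and Henselian subrings of k[[x, y]] *)

Section SubringType.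
Variables (R : comNzRingType) (S : set R).
Hypothesis HS : subring_set S.

Definition mem_subring of subring_set S : {pred R} := fun x => `[< S x >].

Fact mem_subring_closed : subring_closed (mem_subring HS).
Proof.
split=> [|a b /asboolP Sa /asboolP Sb|a b /asboolP Sa /asboolP Sb]; apply/asboolP.
- exact: subring1.
- exact: subringB.
- exact: subringM.
Qed.
HB.instance Definition _ :=
  GRing.isSubringClosed.Build R (mem_subring HS) mem_subring_closed.

Record subring_type :=
  SubringType { subring_val : R; _ : subring_val \in mem_subring HS }.
HB.instance Definition _ := [isSub for subring_val].
HB.instance Definition _ := [Choice of subring_type by <:].
HB.instance Definition _ := [SubChoice_isSubComNzRing of subring_type by <:].

Lemma subring_valP (x : subring_type) : S (val x).
Proof. exact/asboolP/(valP x). Qed.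

Lemma subring_lift a : S a -> exists x : subring_type, val x = a.
Proof.
by move=> Sa; have aS : a \in mem_subring HS by [apply/asboolP]; exists (SubringType aS).
Qed.

End SubringType.

Section Ideals.
Variable A : comNzRingType.
Implicit Types (I J P : set A) (a b c x : A) (s : seq A).

Lemma idealB I a b : is_ideal I -> I a -> I b -> I (a - b).
Proof.
by case=> _ ID IM Ia Ib; apply: ID => //; rewrite -mulN1r; apply: IM.
Qed.

Lemma ideal_gen_cons x s a :
  ideal_gen (x :: s) a <-> exists c b, ideal_gen s b /\ a = c * x + b.
Proof.
split=> [[c ->]|[c [b [[c' ->] ->]]]].
  exists (c ord0), (\sum_(i < size s) c (lift ord0 i) * s`_i).
  by split; [exists (fun i => c (lift ord0 i)) | rewrite big_ord_recl].
exists (fun i => if unlift ord0 i is Some j then c' j else c).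
rewrite big_ord_recl unlift_none; congr (_ + _).
by apply: eq_bigr => i _; rewrite liftK.
Qed.

Lemma ideal_gen_nil a : ideal_gen [::] a <-> a = 0.
Proof.
split=> [[c ->]|->]; first by rewrite big_ord0.
by exists (fun=> 0); rewrite big_ord0.
Qed.

Lemma ideal_gen_map x s a : ideal_gen s a -> ideal_gen [seq x * y | y <- s] (x * a).
Proof.
elim: s a => [|y s IH] a.
  by move=> /ideal_gen_nil ->; rewrite mulr0; apply/ideal_gen_nil.
move=> /ideal_gen_cons [c [b [sb ->]]]; apply/ideal_gen_cons.
by exists c, (x * b); split; [apply: IH | rewrite mulrDr mulrCA].
Qed.

Lemma ideal_gen_sub I s : is_ideal I -> (forall x, x \in s -> I x) -> ideal_gen s `<=` I.
Proof.
move=> [I0 ID IM] sI _ [c ->]; apply: big_ind => // i _.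
by apply: IM; apply: sI; apply: mem_nth.
Qed.

Lemma prime_exp P a n : prime_ideal P -> P (a ^+ n) -> P a.
Proof.
move=> [_ P1 PM]; elim: n => [//|n IH].
by rewrite exprS => /PM [].
Qed.

End Ideals.

Section LocalSubring.
Variables (k : fieldType) (S : set (fps (fps k))).
Hypothesis HS : subring_set S.
Hypothesis Sx : S (fps_const (fps_X k)).
Hypothesis Sy : S (fps_X (fps k)).
Hypothesis Sres : forall F, S F -> S (fps_const (coef F 0)).
Hypothesis Salg : alg S `<=` S.

Local Notation A := (subring_type HS).
Implicit Types (a b c f p : A) (I J P : set A).

(** The quotient is a root of b X - a, hence algebraic over [S]. *)
Lemma quotient_closed a b q : b != 0 -> val a = val b * q -> exists c, val c = q.
Proof.
move=> b0 abq; apply: subring_lift; apply: Salg.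
exists (val b *: 'X - (val a)%:P); split.
- move=> i; rewrite coefB coefZ coefX coefC.
  apply: (subringB HS); last first.
    by case: ifP => _; [apply: subring_valP | apply: (subring0 HS)].
  by apply: (subringM HS); [apply: subring_valP | apply: (subring_nat HS)].
- apply/eqP => /(congr1 (fun q : {poly _} => q`_1)).
  rewrite coefB coefZ coefX coefC coef0 /= mulr1 subr0 => /eqP.
  by rewrite -(rmorph0 (val : A -> _)) (inj_eq val_inj) (negPf b0).
- by rewrite rootE !hornerE abq subrr.
Qed.

Let x : A := SubringType (introT (asboolP _) Sx : _ \in mem_subring HS).
Let y : A := SubringType (introT (asboolP _) Sy : _ \in mem_subring HS).

Lemma y_neq0 : y != 0.
Proof.
apply/eqP => /(congr1 (fun a => coef (coef (val a) 1) 0)) /eqP.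
by rewrite /= oner_eq0.
Qed.

Lemma x_neq0 : x != 0.
Proof.
apply/eqP => /(congr1 (fun a => coef (coef (val a) 0) 1)) /eqP.
by rewrite /= oner_eq0.
Qed.

Lemma div_y a : coef (val a) 0 = 0 -> exists b, a = y * b.
Proof.
move=> a0; have aE : val a = val y * fps_divX (val a).
  by rewrite [LHS]fps_divXK a0 rmorph0 add0r.
have [b bE] := quotient_closed y_neq0 aE; exists b.
by apply: val_inj; rewrite rmorphM /= bE.
Qed.

Lemma lift_res a : exists b, val b = fps_const (coef (val a) 0).
Proof. by apply: subring_lift; apply: Sres; apply: subring_valP. Qed.

Definition at_origin a : k := coef (coef (val a) 0) 0.

Lemma at_origin_unit a : at_origin a != 0 -> exists b, a * b = 1.
Proof.
move=> a0; have [g0 g0E] := fps_unit_coef0 (f := coef (val a) 0) (etrans (unitfE _) a0).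
have aU : coef (val a) 0 \is a GRing.unit by apply/unitrPr; exists g0.
have [g gE] := fps_unit_coef0 aU.
have a00 : a != 0.
  by apply: contraNneq a0 => ->.
have vE : val (1 : A) = val a * g by rewrite gE rmorph1.
have [b bE] := quotient_closed a00 vE; exists b.
by apply: val_inj; rewrite rmorphM /= bE.
Qed.

Definition origin_ideal : set A := [set a | at_origin a = 0].

Lemma origin_idealP : is_ideal origin_ideal.
Proof.
split=> [|a b|a b]; rewrite /origin_ideal /at_origin /mkset; first by [].
  by rewrite rmorphD !fps_coefD => -> ->; rewrite addr0.
by rewrite rmorphM !fps_coef0M => ->; rewrite mulr0.
Qed.

Lemma origin_ideal1 : ~ origin_ideal 1.
Proof. by rewrite /origin_ideal /at_origin /= => /eqP; rewrite oner_eq0. Qed.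

Lemma proper_sub_origin J : is_ideal J -> ~ J 1 -> J `<=` origin_ideal.
Proof.
move=> [_ _ JM] J1 a Ja; apply/eqP/negPn/negP => /at_origin_unit [b ab].
by apply: J1; rewrite -ab mulrC; apply: JM.
Qed.

Lemma origin_maximal : maximal_ideal origin_ideal.
Proof.
split; [exact: origin_idealP | exact: origin_ideal1 |].
move=> J HJ mJ J1; apply/seteqP; split=> //; exact: proper_sub_origin.
Qed.

Lemma maximal_origin J : maximal_ideal J -> J = origin_ideal.
Proof.
move=> [HJ J1 Jmax]; apply/esym/Jmax; [exact: origin_idealP | | exact: origin_ideal1].
exact: proper_sub_origin.
Qed.

Lemma local_subring : local A.
Proof.
exists origin_ideal; split; first exact: origin_maximal.
by move=> J /maximal_origin ->.
Qed.

Lemma origin_gen : origin_ideal = ideal_gen [:: x; y].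
Proof.
apply/seteqP; split=> [a a0|]; last first.
  apply: ideal_gen_sub; first exact: origin_idealP.
  by move=> b; rewrite !inE => /pred2P [] ->.
have [b bE] := lift_res a.
have bE' : val b = val x * fps_const (fps_divX (coef (val a) 0)).
  rewrite bE [in LHS](fps_divXK (coef (val a) 0)) -[val x]/(fps_const (fps_X k)).
  rewrite -rmorphM /=; congr fps_const.
  by rewrite (a0 : coef (coef _ _) _ = 0) rmorph0 add0r.
have [c cE] := quotient_closed x_neq0 bE'.
have [|e eE] := @div_y (a - b); first by rewrite rmorphB /= bE subrr.
apply/ideal_gen_cons; exists c, (y * e); split.
  by apply/ideal_gen_cons; exists e, 0; rewrite addr0 mulrC; split=> //; apply/ideal_gen_nil.
have -> : c * x = b by apply: val_inj; rewrite rmorphM /= cE bE' mulrC.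
by rewrite -eE addrC subrK.
Qed.

(** One step of division by [f] modulo y: [p] lies in the ideal (f, y). *)
Definition reduces f p := exists c b, p = c * f + y * b.

(** At y = 0 the division takes place in the valuation ring k[[x]], where order decides
    divisibility. Both restrictions lie in [S], hence so does their quotient, and the difference is
    divisible by y. *)
Lemma reduces_order f p n u : val f != 0 -> coef (val f) 0 = fps_X k ^+ n * u ->
  coef u 0 != 0 -> ordge n (coef (val p) 0) -> reduces f p.
Proof.
move=> f0 fE u0 /ordgeE pE.
have [g gE] := fps_unit_coef0 (f := u) (etrans (unitfE _) u0).
have [p' p'E] := lift_res p; have [f' f'E] := lift_res f.
set w := fps_shift n _ in pE.
have f'0 : f' != 0.
  rewrite -(inj_eq val_inj) f'E rmorph0 -(rmorph0 (@fps_const (fps k))).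
  rewrite (inj_eq (@fps_const_inj _)) fE.
  apply/eqP => /(congr1 (fun h => coef h n)); rewrite fps_coefXnM ltnn subnn.
  by apply/eqP.
have p'f' : val p' = val f' * fps_const (w * g).
  rewrite p'E f'E -rmorphM; congr fps_const; rewrite pE fE.
  by rewrite -[LHS]mulr1 -gE; ring.
have [c cE] := quotient_closed f'0 p'f'.
have [|b bE] := @div_y (p - c * f); last first.
  by exists c, b; rewrite -bE addrC subrK.
have -> : val (p - c * f) = val p - val c * val f by rewrite rmorphB rmorphM.
rewrite cE fps_coefB fps_coef0M pE fE [coef (fps_const _) 0]/=.
have -> : fps_X k ^+ n * w - w * g * (fps_X k ^+ n * u) = fps_X k ^+ n * w * (1 - u * g).
  by ring.
by rewrite gE subrr mulr0.
Qed.

(** Take [f] in [J] whose restriction to y = 0 has least order in x, or 0 if all restrictions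
    vanish. *)
Lemma exists_reducer J : J 0 -> exists2 f, J f & forall p, J p -> reduces f p.
Proof.
move=> J0; have [allJ|/existsNP [p0 /not_implyP [Jp0 /eqP p00]]] :=
    pselect (forall p, J p -> coef (val p) 0 = 0).
  exists 0 => // p /allJ /div_y [b ->]; exists 0, b.
  by rewrite mul0r add0r.
have exn : exists n, `[< exists2 p, J p & coef (coef (val p) 0) n != 0 >].
  by have [n pn _] := fps_order_ex p00; exists n; apply/asboolP; exists p0.
case: (ex_minnP exn) => n /asboolP [f Jf fn] nmin.
have ordJ p : J p -> ordge n (coef (val p) 0).
  move=> Jp i i_n; apply/eqP/negPn/negP => pi; move: i_n.
  by rewrite ltnNge nmin //; apply/asboolP; exists p.
exists f => // p /ordJ; apply: (reduces_order (u := fps_shift n (coef (val f) 0))).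
- by apply: contraNneq fn => ->.
- exact/ordgeE/ordJ.
- by rewrite /= addn0.
Qed.

(* The successive quotients add up to a quotient in k[[x]][[y]]. *)
Lemma reducer_generates J f : is_ideal J -> J f ->
    (forall n p, J (y ^+ n * p) -> reduces f p) ->
  forall p, J p -> exists q, p = q * f.
Proof.
move=> HJ Jf red p Jp; have [J0 JD JM] := HJ.
have [np|F FP] := choice (P := fun (np : nat * A) (cb : A * A) =>
    J (y ^+ np.1 * np.2) -> np.2 = cb.1 * f + y * cb.2).
  have [/red [c [b E]]|nJ] := pselect (J (y ^+ np.1 * np.2)).
    by exists (c, b).
  by exists (0, 0) => /nJ.
(* [P n] is the remainder and [q n] the partial quotient after n divisions: p = q_n f + y^n P_n. *)
pose P := fix P n := if n is m.+1 then (F (m, P m)).2 else p.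
pose q n := \sum_(i < n) y ^+ i * (F (nat_of_ord i, P i)).1.
have JP n : J (y ^+ n * P n).
  elim: n => [|n IH]; first by rewrite expr0 mul1r.
  have -> : y ^+ n.+1 * P n.+1 = y ^+ n * P n - y ^+ n * (F (n, P n)).1 * f.
    by rewrite [X in _ * X - _](FP (n, P n) IH) /= exprSr; ring.
  by apply: idealB => //; apply: JM.
have pE n : p = q n * f + y ^+ n * P n.
  elim: n => [|n IH]; first by rewrite /q big_ord0 mul0r add0r expr0 mul1r.
  rewrite [LHS]IH /q big_ord_recr /= [X in _ + _ * X](FP (n, P n) (JP n)) /= exprSr.
  by ring.
have valyXn n a : val (y ^+ n * a) = fps_X (fps k) ^+ n * val a.
  by rewrite rmorphM rmorphXn.
have [Q QP] : exists Q, forall n, ordge n (Q - val (q n)).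
  have qS n : q n.+1 = q n + y ^+ n * (F (n, P n)).1 by rewrite /q big_ord_recr.
  apply: ordge_limit => n.
  have -> : val (q n.+1) = val (q n) + val (y ^+ n * (F (n, P n)).1).
    by rewrite qS rmorphD.
  by rewrite valyXn addrAC subrr add0r; apply: ordge_mulXn.
have pQ : val p = val f * Q.
  apply/eqP; rewrite -subr_eq0; apply/eqP/ordge_eq0 => n.
  have -> : val p = val (q n) * val f + val (y ^+ n * P n).
    by rewrite [in LHS](pE n) rmorphD rmorphM.
  rewrite valyXn.
  have -> : val (q n) * val f + fps_X (fps k) ^+ n * val (P n) - val f * Q
     = fps_X (fps k) ^+ n * val (P n) - (Q - val (q n)) * val f by ring.
  by apply: ordge_sub; [apply: ordge_mulXn | apply: ordge_mulr].
have [f0|f0] := eqVneq f 0.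
  by exists 0; apply: val_inj; rewrite pQ mul0r f0 rmorph0 mul0r.
have [c cE] := quotient_closed f0 pQ; exists c.
by apply: val_inj; rewrite rmorphM /= cE pQ mulrC.
Qed.

(** Let [f] reduce every p having some y^n p in I, with y^N f in I, and induct on N. For N = 0, [f]
    generates I. Otherwise the colon ideal of y in I works with the same [f] and exponent N - 1; y
    times its generators, together with a reducer of I itself, generate I. *)
Lemma noetherian_subring : noetherian A.
Proof.
move=> I HI; have [I0 _ _] := HI.
have [|f [N If] fred] := @exists_reducer (fun p => exists n, I (y ^+ n * p)).
  by exists 0%N; rewrite mulr0.
have {}fred n p : I (y ^+ n * p) -> reduces f p by move=> Ip; apply: fred; exists n.
elim: N I HI I0 If fred => [|N IH] I HI I0 If fred.
  exists [:: f]; rewrite expr0 mul1r in If.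
  apply/seteqP; split=> [p Ip|]; last first.
    by apply: ideal_gen_sub => // a; rewrite inE => /eqP ->.
  have [q ->] := reducer_generates HI If fred Ip.
  apply/ideal_gen_cons; exists q, 0; rewrite addr0; split=> //.
  exact/ideal_gen_nil.
have HJ : is_ideal [set a | I (y * a)].
  case: HI => _ ID IM; split=> /= [|a b Ia Ib|a b Ib].
  - by rewrite mulr0.
  - by rewrite mulrDr; apply: ID.
  - by rewrite mulrCA; apply: IM.
have [|||s sE] := IH _ HJ; rewrite /= ?mulr0 //.
- by rewrite mulrA -exprS.
- by move=> n p; rewrite mulrA -exprS; apply: fred.
have [g Ig gred] := exists_reducer I0.
exists (g :: [seq y * a | a <- s]); apply/seteqP; split=> [p Ip|].
  have [c [b pE]] := gred p Ip; apply/ideal_gen_cons; exists c, (y * b).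
  split=> //; apply: ideal_gen_map; rewrite -sE /=.
  have -> : y * b = p - c * g by rewrite pE addrC addKr.
  by apply: idealB => //; case: HI => _ _; apply.
apply: ideal_gen_sub => // a; rewrite inE => /predU1P [->//|/mapP [b bs ->]].
have : ideal_gen s b.
  elim: (s) bs => // a' s' IHs; rewrite inE => /predU1P [->|/IHs sb].
    apply/ideal_gen_cons; exists 1, 0; rewrite mul1r addr0; split=> //.
    by exists (fun=> 0); rewrite big1 // => i _; rewrite mul0r.
  by apply/ideal_gen_cons; exists 0, b; rewrite mul0r add0r.
by rewrite -sE.
Qed.

(** If y is not in P, then y can be cancelled inside P and a reducer generates it. If y is in P,
    then either P = (y), or some element of P restricts to x^n times a unit, so that x is in P as
    well. *)
Lemma prime_origin_or_principal P : prime_ideal P ->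
  P = origin_ideal \/ exists2 f, P f & forall p, P p -> exists q, p = q * f.
Proof.
move=> HP; have [HI P1 PM] := HP; have [P0 PD PMl] := HI.
have [Py|nPy] := pselect (P y); last first.
  right; have [f Pf fred] := exists_reducer P0; exists f => // p.
  apply: reducer_generates => // n {}p /PM [/prime_exp Py|/fred //].
  by case: nPy; apply: Py.
have [Pall|/existsNP [p0 /not_implyP [Pp0 /eqP p00]]] :=
    pselect (forall p, P p -> coef (val p) 0 = 0).
  by right; exists y => // p /Pall /div_y [b ->]; exists b; rewrite mulrC.
left; apply/seteqP; split; first exact: proper_sub_origin.
suff Px : P x.
  by rewrite origin_gen; apply: ideal_gen_sub => // a; rewrite !inE => /pred2P [] ->.
have [n [u [pE u0]]] := fps_order p00.
have [g gE] := fps_unit_coef0 (f := u) (etrans (unitfE _) u0).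
have [c cE] := lift_res p0.
have Pc : P c.
  have [|b bE] := @div_y (p0 - c); first by rewrite rmorphB /= cE subrr.
  have -> : c = p0 - b * y by rewrite mulrC -bE opprB addrC subrK.
  by apply: idealB => //; apply: PMl.
have c0 : c != 0.
  apply: contraNneq p00 => c0; move: cE; rewrite c0.
  by move=> /(congr1 (fun h : fps (fps k) => coef h 0)) /= <-.
have xE : val (x ^+ n) = val c * fps_const g.
  rewrite rmorphXn cE pE /= -rmorphM -rmorphXn; congr fps_const.
  by rewrite -mulrA gE mulr1.
have [e eE] := quotient_closed c0 xE.
apply: (@prime_exp _ _ _ n) => //.
have -> : x ^+ n = e * c by apply: val_inj; rewrite xE rmorphM /= eE mulrC.
exact: PMl.
Qed.

Lemma subring_type_mulf_eq0 a b : a * b = 0 -> a = 0 \/ b = 0.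
Proof.
move=> /(congr1 val); rewrite rmorphM rmorph0 => /eqP; rewrite mulf_eq0.
by case/orP => /eqP ab; [left | right]; apply: val_inj; rewrite ab rmorph0.
Qed.

(** Write f = c g, a product lying in the prime P. If c were in P, it would be a multiple of f, and
    g would be a unit; so g is in P. *)
Lemma principal_primes P Q f g : prime_ideal P -> prime_ideal Q -> P `<=` Q ->
    (exists2 a, P a & a <> 0) ->
    P f -> (forall p, P p -> exists q, p = q * f) ->
    Q g -> (forall p, Q p -> exists q, p = q * g) ->
  Q `<=` P.
Proof.
move=> [[P0 PD PMl] P1 PM] [[Q0 QD QMl] Q1 _] PQ [a Pa a0] Pf fP Qg gQ.
have f0 : f <> 0 by move=> f0; have [q aE] := fP a Pa; apply: a0; rewrite aE f0 mulr0.
have [c fE] := gQ f (PQ f Pf).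
have [|Pc|Pg] := PM c g; first by rewrite -fE.
  have [e cE] := fP c Pc; have : f * (1 - e * g) = 0.
    by rewrite mulrBr mulr1 {1}fE cE; ring.
  move=> /subring_type_mulf_eq0 [//|/eqP]; rewrite subr_eq0 => /eqP e1.
  by case: Q1; rewrite e1; apply: QMl.
by move=> p /gQ [q ->]; apply: PMl.
Qed.

Lemma krull_dim_subring : krull_dim A 2.
Proof.
split.
  exists (fun i => match i with
    | 0 => [set 0] | 1 => [set a | coef (val a) 0 = 0] | _ => origin_ideal end).
  split=> [[|[|i]] _|[|[|i]] // _].
  - split=> [||a b /subring_type_mulf_eq0 //].
      by split=> [//|a b -> ->|a b ->]; rewrite ?addr0 ?mulr0.
    by move=> /(congr1 val); rewrite rmorph1 rmorph0 => /eqP; rewrite oner_eq0.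
  - split=> [||a b]; rewrite /mkset.
    + split=> [|a b|a b]; rewrite /mkset; first by [].
        by rewrite rmorphD fps_coefD => -> ->; rewrite addr0.
      by rewrite rmorphM fps_coef0M => ->; rewrite mulr0.
    + by move=> /eqP; rewrite oner_eq0.
    + by rewrite rmorphM fps_coef0M => /eqP; rewrite mulf_eq0 => /orP [] /eqP; [left | right].
  - split=> [||a b]; [exact: origin_idealP | exact: origin_ideal1 |].
    rewrite /origin_ideal /at_origin /mkset rmorphM !fps_coef0M => /eqP; rewrite mulf_eq0.
    by case/orP => /eqP; [left | right].
  - split=> [a -> //|/(_ y) /=]; apply/not_implyP; split=> //.
    exact/eqP/y_neq0.
  - split=> [a|/(_ x) /=]; first by rewrite /origin_ideal /at_origin /= => ->.
    apply/not_implyP; split=> // /(congr1 (fun h : fps k => coef h 1)) /eqP.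
    by rewrite /= oner_eq0.
(* In a chain of length 3, [P 1] and [P 2] each lie strictly below another prime, so both are
   principal; as [P 1] is nonzero, they coincide. *)
move=> l P [Pprime Plt]; rewrite leqNgt; apply/negP => l2.
have [Pp1 Pp2 Pp3] : [/\ prime_ideal (P 1), prime_ideal (P 2) & prime_ideal (P 3)].
  by split; apply: Pprime; lia.
have [lt01 lt12 lt23] : [/\ P 0 `<` P 1, P 1 `<` P 2 & P 2 `<` P 3].
  by split; apply: Plt; lia.
have not_origin Q Q' : prime_ideal Q' -> Q `<` Q' -> Q <> origin_ideal.
  move=> [HQ' Q'1 _] [QQ' nQ'Q] QE; apply: nQ'Q; rewrite QE.
  exact: proper_sub_origin.
have [/(not_origin _ _ Pp2 lt12)//|[f Pf fP]] := prime_origin_or_principal Pp1.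
have [/(not_origin _ _ Pp3 lt23)//|[g Pg gP]] := prime_origin_or_principal Pp2.
case: lt12 => P12 []; apply: (principal_primes Pp1 Pp2 P12 _ Pf fP Pg gP).
case: lt01 => _ /existsNP [a /not_implyP [Pa nPa]]; exists a => // a0.
apply: nPa; rewrite a0; have [[] //] := Pprime 0%N isT.
Qed.

Lemma regular_local_subring : regular_local A.
Proof.
split; [exact: noetherian_subring | exact: local_subring |].
move=> m /maximal_origin ->; exists [:: x; y].
by split; [exact: origin_gen | exact: krull_dim_subring].
Qed.

(** The root is lifted from k to k[[x]] and then to k[[x]][[y]]; being algebraic over [S], it lies
    in [S]. *)
Lemma henselian_local_subring : henselian_local A.
Proof.
split=> [|m /maximal_origin -> p a pmon pa0 p'a0]; first exact: local_subring.
pose valR : {rmorphism A -> fps (fps k)} := val.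
pose pv : {poly fps (fps k)} := map_poly val p.
pose p0 := map_poly (@fps_coef0 (fps k)) pv.
have ev0 (q : {poly A}) b :
    coef (val q.[b]) 0 = (map_poly (@fps_coef0 (fps k)) (map_poly val q)).[coef (val b) 0].
  have -> : val q.[b] = (map_poly val q).[val b] := esym (horner_map valR q b).
  exact: (esym (horner_map (@fps_coef0 (fps k)) (map_poly val q) (val b))).
have ev00 (q : {poly fps k}) (b : fps k) :
    coef q.[b] 0 = (map_poly (@fps_coef0 k) q).[coef b 0].
  exact: (esym (horner_map (@fps_coef0 k) q b)).
have dE : p0^`() = map_poly (@fps_coef0 (fps k)) (map_poly val p^`()).
  by rewrite /p0 /pv !deriv_map.
have [||b0 b0r b0E] := @hensel k p0 (at_origin a).
- by rewrite rootE /at_origin -ev00 -ev0; apply/eqP.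
- by rewrite unitfE deriv_map -ev00 dE -ev0; apply/eqP.
have [||b br bE] := @hensel (fps k) pv b0.
- exact: b0r.
- have [g gE] : exists g, p0^`().[b0] * g = 1; last by apply/unitrPr; exists g.
  apply: fps_unit_coef0; rewrite unitfE ev00 b0E /at_origin -ev00.
  by rewrite dE -ev0; apply/eqP.
have [c cE] : exists c : A, val c = b.
  apply: subring_lift; apply: Salg; exists pv; split=> //.
    by move=> i; rewrite coef_map; apply: subring_valP.
  by rewrite monic_neq0 // monic_map.
exists c; split.
  apply: val_inj; rewrite rmorph0 -cE in br *.
  by rewrite -[LHS](horner_map valR p c); apply/rootP.
have vE : val (c - a) = val c - val a := rmorphB valR c a.
rewrite /origin_ideal /at_origin /mkset vE cE !fps_coefB bE b0E.
exact: subrr.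
Qed.

End LocalSubring.

(** * Exponentials are transcendental over the constants *)

Section Constants.
Variables (B : idomainType) (d : B -> B).
Hypothesis dd : derivation d.
Hypothesis char0 : forall m, m.+1%:R != 0 :> B.

Definition constants : set B := [set a | d a = 0].

Lemma constants_subring : subring_set constants.
Proof.
split=> [|a b|a b]; rewrite /constants /mkset; first exact: (der1 dd).
  by move=> a0 b0; rewrite (derB dd) a0 b0 subrr.
by move=> a0 b0; rewrite (derM dd) a0 b0 mul0r mulr0 addr0.
Qed.

Lemma der_horner_constants p a : poly_in constants p -> d p.[a] = p^`().[a] * d a.
Proof.
move=> pC; rewrite (der_horner dd); have -> : \poly_(i < size p) d p`_i = 0.
  by apply/polyP => i; rewrite coef_poly coef0 (pC i : d _ = 0) if_same.
by rewrite horner0 add0r.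
Qed.

Lemma deriv_eq0 (p : {poly B}) : p^`() = 0 -> p = (p`_0)%:P.
Proof.
move=> p'0; apply/polyP => -[|i]; first by rewrite coefC.
rewrite coefC /=; have := congr1 (fun q : {poly B} => q`_i) p'0.
rewrite coef_deriv coef0 -mulr_natr => /eqP.
by rewrite mulf_eq0 (negPf (char0 i)) orbF => /eqP.
Qed.

Lemma alg_constants a : alg constants a -> d a = 0.
Proof.
move=> [p [pC p0 pa]]; apply/eqP; move: p0; apply: contraTT => da.
have [n] := ubnP (size p); elim: n => // n IH in p pC pa *.
rewrite ltnS => pn; apply/negPn; have [p'0|p'0] := eqVneq p^`() 0.
  by move: pa; rewrite (deriv_eq0 p'0) rootC => /eqP ->.
have p_gt0 : (0 < size p)%N.
  by rewrite size_poly_gt0; apply: contraNneq p'0 => ->; rewrite deriv0.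
case/negP: p'0; apply: negbNE; apply: (IH p^`()).
- exact: (poly_in_deriv constants_subring).
- have := der_horner_constants a pC; rewrite (rootP pa) (der0 dd) => /esym/eqP.
  by rewrite mulf_eq0 (negPf da) orbF.
- by apply: leq_trans pn; apply: lt_size_deriv; rewrite -size_poly_gt0.
Qed.

Lemma horner2_coef (P : {poly {poly B}}) (u v : B) n : (size P <= n)%N ->
  P.[u, v] = \sum_(i < n) (P`_i).[v] * u ^+ i.
Proof.
move=> Pn; rewrite (horner_coef_wide _ Pn) horner_sum; apply: eq_bigr => i _.
by rewrite hornerM horner_exp hornerC.
Qed.

(* With n the degree of P in u, the derivative of P(u, v) minus n d(v) P(u, v) is
   d(v) Q(u, v), where the top coefficient of Q is the derivative of that of P. *)
Lemma exp_alg_indep u v (P : {poly {poly B}}) :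
    u != 0 -> d v != 0 -> d u = u * d v ->
  poly2_in constants P -> P.[u, v] = 0 -> P = 0.
Proof.
move=> u0 dv0 duE PC Puv; apply/eqP/negPn/negP => P0.
have HC := constants_subring.
(* The induction is on the total size of the coefficients, which drops from [P] to [Q] because the
   top coefficient is differentiated. *)
pose mu (Q : {poly {poly B}}) := (\sum_(i < size Q) size (Q`_i)%R)%N.
have muE (Q : {poly {poly B}}) n : (size Q <= n)%N -> mu Q = (\sum_(i < n) size (Q`_i)%R)%N.
  move=> Qn; rewrite /mu (big_ord_widen n (fun i => size (Q`_i)%R) Qn).
  rewrite [RHS](bigID (fun i : 'I_n => (i < size Q)%N)) /= [X in (_ + X)%N]big1 ?addn0 //.
  by move=> i; rewrite -leqNgt => Qi; rewrite nth_default ?size_poly0.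
have [m] := ubnP (mu P); elim: m => // m IH in P PC Puv P0 *.
rewrite ltnS => Pm; set n := (size P).-1.
have Pn : size P = n.+1 by rewrite /n prednK // size_poly_gt0.
(* The derivative of p_i(v) u^i is (p_i' + i p_i)(v) u^i d(v); subtracting n p_i leaves p_i' - (n -
   i) p_i. *)
pose Q := \poly_(i < n.+1) ((P`_i)^`() - P`_i *+ (n - i)).
have Qsz : (size Q <= n.+1)%N := size_poly _ _.
have QE i : (i < n.+1)%N -> Q`_i = (P`_i)^`() - P`_i *+ (n - i).
  by move=> i_n; rewrite coef_poly i_n.
have QC : poly2_in constants Q.
  move=> i; rewrite coef_poly; have HP := poly_in_subring HC.
  case: ifP => _; last exact: (subring0 HP).
  by apply: (subringB HP); [apply: poly_in_deriv | apply: (subringMn HP)].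
have Quv : Q.[u, v] = 0.
  apply: (mulIf dv0); rewrite mul0r.
  have dP : d P.[u, v] - (P.[u, v] * d v) *+ n = 0.
    by rewrite Puv (der0 dd) mul0r mul0rn subrr.
  rewrite -[RHS]dP (horner2_coef _ _ Qsz) (horner2_coef (P := P) _ _ (n := n.+1)) ?Pn //.
  rewrite (der_sum dd) !mulr_suml -sumrMnl -sumrB; apply: eq_bigr => i _.
  rewrite (derM dd) (der_horner_constants _ (PC i)) (derXn dd) duE QE //.
  rewrite hornerD hornerN hornerMn.
  have -> : u ^+ i.-1 * (u * d v) *+ i = u ^+ i * d v *+ i.
    by case: (nat_of_ord i) => [|i'] //=; rewrite exprSr mulrA.
  have ni : n = (n - i + i)%N by rewrite subnK // -ltnS.
  rewrite [X in _ = _ - _ *+ X]ni mulrnDr.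
  move: (nat_of_ord i : nat) (u ^+ i) (P`_i).[v] (P`_i)^`().[v] (d v) (n - i)%N
    => b U p p' dv a.
  rewrite -(mulr_natr p a) -(mulr_natr (U * dv) b).
  by rewrite -(mulr_natr (p * U * dv) a) -(mulr_natr (p * U * dv) b); ring.
have muQP : (mu Q < mu P)%N.
  rewrite (muE Q n.+1) // (muE P n.+1) ?Pn // !big_ord_recr /=.
  rewrite -addnS leq_add //.
    apply: leq_sum => i _; rewrite QE ?(ltn_trans (ltn_ord i)) //.
    apply: leq_trans (size_polyD _ _) _; rewrite size_polyN geq_max.
    rewrite -scaler_nat size_scale_leq andbT.
    have [->|Pi0] := eqVneq P`_i 0; first by rewrite deriv0.
    exact/ltnW/lt_size_deriv.
  rewrite QE // subnn mulr0n subr0 lt_size_deriv //.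
  by rewrite -lead_coefE lead_coef_eq0.
have [Q0|/(IH Q QC Quv)] := eqVneq Q 0; last first.
  by apply; apply: leq_trans muQP Pm.
(* When Q = 0, p_i' = (n - i) p_i forces p_i = 0 for i < n by comparing degrees, and p_n is a
   constant; so P(u, v) = 0 reads c u^n = 0. *)
have Pi0 i : (i < n)%N -> P`_i = 0.
  move=> i_n; have /eqP := congr1 (fun R : {poly {poly B}} => R`_i) Q0.
  rewrite (QE _ (leqW i_n)) coef0 subr_eq0 => /eqP Pi; apply/eqP/negPn/negP => Pi0.
  have := lt_size_deriv Pi0; rewrite Pi -scaler_nat -(subnSK i_n) size_scale ?ltnn //.
have Pn' : (P`_n)^`() = 0.
  have := congr1 (fun R : {poly {poly B}} => R`_n) Q0.
  by rewrite QE // coef0 subnn mulr0n subr0.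
have Pn0 : P`_n != 0 by rewrite -lead_coefE lead_coef_eq0.
move: Puv; rewrite (horner2_coef (P := P) _ _ (n := n.+1)) ?Pn // big_ord_recr /= big1 ?add0r.
  move=> /eqP; rewrite mulf_eq0 expf_eq0 (negPf u0) andbF orbF (deriv_eq0 Pn') hornerC.
  by move=> /eqP c0; move: Pn0; rewrite (deriv_eq0 Pn') c0 eqxx.
by move=> i _; rewrite Pi0 // horner0 mul0r.
Qed.

End Constants.

(** * Taylor flows *)

Section Flow.
Variables (R : comUnitRingType) (d : R -> R).
Hypothesis dd : derivation d.
Hypothesis natU : forall m, m.+1%:R \is a @GRing.unit R.

(** The coefficients d^m z / m! of the exponential series exp (s d) z. *)
Fixpoint flow_coef z m := if m is n.+1 then n.+1%:R^-1 * d (flow_coef z n) else z.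
Definition flow (z : R) : fps R := Fps (flow_coef z).

Definition is_flow (f : fps R) := fps_deriv f = fps_map d f.

Lemma flowP z : is_flow (flow z).
Proof. by apply: fpsP => n /=; rewrite -[LHS]mulr_natl mulVKr. Qed.

(** Uniqueness for the equation df/ds = d f with given initial value. The identities between flows
    below, multiplicativity included, are obtained by checking that both sides solve it. *)
Lemma is_flow_eq f g : is_flow f -> is_flow g -> coef f 0 = coef g 0 -> f = g.
Proof.
move=> fF gF fg0; apply: fpsP; elim=> // n IH.
apply: (mulrI (natU n)); rewrite !mulr_natl.
have := congr1 (fun h => coef h n) fF; have := congr1 (fun h => coef h n) gF.
by rewrite /= => -> ->; rewrite IH.
Qed.

Lemma flow_is_zmod_morphism : zmod_morphism flow.
Proof.
move=> a b; apply: is_flow_eq; [exact: flowP | | by []].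
rewrite /is_flow (derB (fps_deriv_derivation R)) !flowP.
by rewrite (derB (fps_map_derivation dd)).
Qed.

Lemma flow_is_monoid_morphism : monoid_morphism flow.
Proof.
have dfps := fps_deriv_derivation R; have dmap := fps_map_derivation dd.
split=> [|a b]; apply: is_flow_eq; try exact: flowP.
- by rewrite /is_flow (der1 dfps) (der1 dmap).
- by rewrite fps_coef1.
- by rewrite /is_flow (derM dfps) (derM dmap) !flowP.
- by rewrite fps_coef0M.
Qed.

(** Carries the hypotheses as arguments, so that the ring morphism structure can be attached to
    it. *)
Definition flow_morph of derivation d & (forall m, m.+1%:R \is a @GRing.unit R) := flow.
HB.instance Definition _ := GRing.isZmodMorphism.Build R (fps R)
  (flow_morph dd natU) flow_is_zmod_morphism.
HB.instance Definition _ := GRing.isMonoidMorphism.Build R (fps R)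
  (flow_morph dd natU) flow_is_monoid_morphism.

Lemma flow_d z : fps_deriv (flow z) = flow (d z).
Proof.
apply: is_flow_eq; [| exact: flowP |].
  rewrite /is_flow !flowP; apply: fpsP => n; rewrite /= -(derMn dd).
  by congr d; apply: (congr1 (fun f => coef f n) (flowP z)).
by rewrite flowP.
Qed.

End Flow.

Lemma flow_map (R S : comUnitRingType) (d : R -> R) (d' : S -> S)
    (rho : {rmorphism R -> S}) z :
    (forall m, m.+1%:R \is a @GRing.unit R) ->
    (forall m, m.+1%:R \is a @GRing.unit S) ->
    (forall a, rho (d a) = d' (rho a)) ->
  fps_map rho (flow d z) = flow d' (rho z).
Proof.
move=> RU SU rd; apply: (is_flow_eq (d := d')) => //; last exact: flowP.
rewrite /is_flow -fps_map_deriv flowP //; apply: fpsP => n /=; exact: rd.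
Qed.

(** * The equation h' = h^2 + h^3 *)

Lemma nat_unit_poly (F : fieldType) : (forall m, m.+1%:R != 0 :> F) ->
  forall m, m.+1%:R \is a @GRing.unit {poly F}.
Proof.
move=> char0 m; rewrite -(rmorph_nat (@polyC F)) poly_unitE size_polyC char0 /=.
by rewrite coefC /= unitfE.
Qed.

Lemma nat_unit_fps (R : comUnitRingType) : (forall m, m.+1%:R \is a @GRing.unit R) ->
  forall m, m.+1%:R \is a @GRing.unit (fps R).
Proof.
move=> RU m; rewrite -(rmorph_nat (@fps_const R)); apply/unitrPr.
by exists (fps_const m.+1%:R^-1); rewrite -rmorphM mulrV ?rmorph1.
Qed.

Lemma alg_frac_image (B : idomainType) (R : set B) u : subring_set R ->
  alg (frac_image R) u%:F <-> alg R u.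
Proof.
move=> HR; rewrite -(alg_frac u HR) FracE; split.
  exact/alg_sub/fracs_id/frac_image_subring.
exact/fracs_alg/frac_image_subring.
Qed.

Lemma poly2_in_image (B C : comNzRingType) (f : {rmorphism B -> C}) (R : set B)
    (P : {poly {poly C}}) : R 0 -> poly2_in [set f a | a in R] P ->
  exists2 Q, poly2_in R Q & P = map_poly (map_poly f) Q.
Proof.
move=> R0 RP.
have RP' : poly_in [set map_poly f q | q in poly_in R] P.
  by move=> i; have [q Rq ->] := poly_in_image (RP i) R0; exists q.
have [|Q RQ ->] := poly_in_image RP'; first by move=> i; rewrite coef0.
by exists Q.
Qed.

Lemma horner2_map (B C : comNzRingType) (f : {rmorphism B -> C}) P u v :
  (map_poly (map_poly f) P).[f u, f v] = f P.[u, v].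
Proof. by rewrite -horner_map /= -(map_polyC f) -horner_map. Qed.

Lemma map_poly2_eq0 (B C : comNzRingType) (f : {rmorphism B -> C})
    (P : {poly {poly B}}) : injective f ->
  (map_poly (map_poly f) P == 0) = (P == 0).
Proof.
move=> finj; rewrite -!size_poly_eq0 size_map_inj_poly ?rmorph0 //.
by apply: map_inj_poly; rewrite ?rmorph0.
Qed.

Definition Phi (R : pzSemiRingType) (r : R) := r ^+ 2 + r ^+ 3.

(* With w = 1/q and z = 1/T, the elements v = z - w and u = (1 + z)/(1 + w)
   satisfy d u = u (d v): both - w + log (1 + w) and - z + log (1 + z) have the
   derivative 1 along the vector field Phi d/dq. *)
Lemma flow_transcendental (B : idomainType) (d : B -> B) (q T w z g : B) P :
    derivation d -> (forall m, m.+1%:R != 0 :> B) ->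
    d q = 1 -> Phi q * d T = Phi T -> q * w = 1 -> T * z = 1 -> (1 + w) * g = 1 ->
    T != q -> T != -1 -> poly2_in (constants d) P -> P != 0 -> P.[T, q] <> 0.
Proof.
move=> dd char0 dq dT qw Tz wg Tq T1 CP P0 PTq.
have HC := constants_subring dd; have HS := frac_image_subring HC.
have q0 : q != 0 by apply: contra_eq_neq qw => ->; rewrite mul0r eq_sym oner_neq0.
have T0 : T != 0 by apply: contra_eq_neq Tz => ->; rewrite mul0r eq_sym oner_neq0.
have w0 : w != 0 by apply: contra_eq_neq qw => ->; rewrite mulr0 eq_sym oner_neq0.
have z0 : z != 0 by apply: contra_eq_neq Tz => ->; rewrite mulr0 eq_sym oner_neq0.
have w10 : 1 + w != 0 by apply: contra_eq_neq wg => ->; rewrite mul0r eq_sym oner_neq0.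
have dw : d w = - w ^+ 2.
  have := congr1 d qw; rewrite (derM dd) (der1 dd) dq mul1r => /eqP.
  rewrite addr_eq0 => /eqP wE; apply: (mulfI q0).
  by rewrite -[LHS]opprK -wE expr2 mulrN mulrA qw mul1r.
(* Phi T / T^2 = 1 + T = (1 + z)/z *)
have dz : z * d z * (1 + w) = w * (1 + z) * d w.
  have dzT : d z = - z ^+ 2 * d T.
    have := congr1 d Tz; rewrite (derM dd) (der1 dd) => /eqP.
    rewrite addrC addr_eq0 => /eqP TE; apply: (mulfI T0); rewrite TE.
    by rewrite mulrA mulrN expr2 mulrA Tz mul1r mulNr mulrC.
  have -> : w * (1 + z) * d w = - (w ^+ 3 * z ^+ 3) * Phi T.
    rewrite dw /Phi; transitivity (- w ^+ 3 * (z * (T * z) ^+ 2 + (T * z) ^+ 3)); last by ring.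
    by rewrite Tz; ring.
  rewrite -dT dzT /Phi.
  transitivity (- z ^+ 3 * d T * ((q * w) ^+ 2 * w + (q * w) ^+ 3)); last by ring.
  by rewrite qw; ring.
set v := z - w; set u := (1 + z) * g.
have wu : (1 + w) * u = 1 + z by rewrite /u mulrCA wg mulr1.
have du : d u = u * d v.
  have := congr1 d wu; rewrite (derM dd) !(derD dd) (der1 dd) !add0r => dwu.
  apply: (mulfI w10); apply: (mulfI w10); rewrite [(1 + w) * (u * _)]mulrA wu.
  have -> : (1 + w) * d u = d z - d w * u by rewrite -dwu [RHS]addrC addKr.
  have -> : (1 + w) * (d z - d w * u) = (1 + w) * d z - d w * ((1 + w) * u) by ring.
  rewrite wu (derN dd); apply/eqP; rewrite -subr_eq0; apply/eqP.
  transitivity (w * (1 + z) * d w - z * d z * (1 + w)); first by ring.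
  by rewrite dz subrr.
(* If v is a constant, z and w have the same nonzero derivative, and [dz] becomes z(1 + w) = w(1 +
   z), so z = w and T = q. *)
have [dv|dv] := eqVneq (d v) 0.
  have dzw : d z = d w by apply/eqP; rewrite -subr_eq0 -(derB dd) dv.
  have dw0 : d w != 0 by rewrite dw oppr_eq0 expf_neq0.
  have zw : z = w.
    move: dz; rewrite dzw mulrAC => /(mulIf dw0); rewrite !mulrDr !mulr1 [w * z]mulrC.
    exact: addIr.
  by case/eqP: Tq; apply: (mulIf w0); rewrite -[in LHS]zw Tz qw.
have u0 : u != 0.
  have z1 : 1 + z != 0.
    apply: contraNneq T1 => z1; rewrite -addr_eq0 -(mulIr_eq0 _ (mulIf z0)).
    by rewrite mulrDl Tz mul1r z1.
  by apply: contraNneq z1 => u0; rewrite -wu u0 mulr0.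
pose S := frac_image (constants d).
have not_alg a : d a != 0 -> ~ alg S a%:F.
  move=> da /(alg_frac_image _ HC) /(alg_constants dd char0) da0.
  by rewrite da0 eqxx in da.
have TM : alg (adj S q%:F) T%:F.
  apply: (adj_alg HS (P := map_poly (map_poly (@FracField.tofrac B)) P)).
  - by apply: not_alg; rewrite dq oner_neq0.
  - by move=> i j; rewrite !coef_map; exists (P`_i)`_j => //; apply: CP.
  - by rewrite map_poly2_eq0 //; apply: tofrac_inj.
  - by rewrite horner2_map PTq rmorph0.
have inv_frac (a b : B) : a * b = 1 -> b%:F = (a%:F)^-1.
  move=> ab; have a0 : a%:F != 0.
    by rewrite tofrac_eq0; apply: contra_eq_neq ab => ->; rewrite mul0r eq_sym oner_neq0.
  by apply: (mulfI a0); rewrite divff // -rmorphM ab rmorph1.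
have closure (M : set {fraction B}) : subfield_set M -> M q%:F -> M T%:F ->
    M v%:F /\ M u%:F.
  move=> HM Mq MT; have Mw : M w%:F by rewrite (inv_frac _ _ qw); apply: subfieldV.
  have Mz : M z%:F by rewrite (inv_frac _ _ Tz); apply: subfieldV.
  have M1 : M 1 := subring1 HM.1.
  split; first by rewrite rmorphB; apply: (subringB HM.1).
  rewrite rmorphM /= (inv_frac _ _ wg); apply: (subringM HM.1); last apply: subfieldV => //.
    by rewrite rmorphD rmorph1; apply: (subringD HM.1).
  by rewrite rmorphD rmorph1; apply: (subringD HM.1).
(* Count of transcendence degree: [v] is algebraic over S(q) but not over S, so by exchange [q],
   then [T], then [u] are algebraic over S(v); [exp_alg_indep] excludes this. *)
have Hq := adj_subfield HS q%:F; have Hv := adj_subfield HS v%:F.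
have [vM _] := closure _ (alg_subfield Hq) (alg_id Hq.1 (adj_gen HS _)) TM.
have qN := alg_exchange HS vM (not_alg _ dv).
have TN : alg (adj S v%:F) T%:F.
  apply: (alg_trans Hv); apply: alg_sub TM; apply: (adj_le (alg_subfield Hv) _ qN).
  by move=> a Sa; apply: (alg_id Hv.1); apply: (adj_base HS).
have [_ /(alg_adj HS) [P3 [SP3 P30 P3uv]]] := closure _ (alg_subfield Hv) qN TN.
have [Q CQ P3E] := poly2_in_image (subring0 HC) SP3.
case/eqP: P30; rewrite P3E; suff -> : Q = 0 by rewrite rmorph0.
apply: (exp_alg_indep dd char0 u0 dv du CQ); apply: tofrac_inj.
by rewrite rmorph0 -P3uv P3E horner2_map.
Qed.

Definition fps_in (R : comNzRingType) (S : set R) : set (fps R) :=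
  [set f | forall n, S (coef f n)].

Lemma fps_in_subring (R : comNzRingType) (S : set R) :
  subring_set S -> subring_set (fps_in S).
Proof.
move=> HS; split=> [n|f g Sf Sg n|f g Sf Sg n].
- by rewrite fps_coef1; apply: (subring_nat HS).
- by rewrite fps_coefB; apply: (subringB HS).
- by rewrite fps_coefM; apply: (subring_sum HS) => i _; apply: (subringM HS).
Qed.

Lemma fps_in_const (R : comNzRingType) (S : set R) c :
  subring_set S -> S c -> fps_in S (fps_const c).
Proof. by move=> HS Sc n /=; case: eqP => // _; apply: (subring0 HS). Qed.

Lemma rmorph_Phi (R S : pzRingType) (f : {rmorphism R -> S}) r : f (Phi r) = Phi (f r).
Proof. by rewrite /Phi rmorphD !rmorphXn. Qed.

Section FlowOfPhi.
Variable F : fieldType.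
Hypothesis char0 : forall m, m.+1%:R != 0 :> F.

(** The indeterminate q, expanded at q = 1 so that q and 1 + 1/q are invertible series. In
    [phi_flow] the outer variable is the time s. *)
Definition phi_q : fps F := 1 + fps_X F.
Definition phi_d (f : fps F) : fps F := Phi phi_q * fps_deriv f.
Definition phi_flow : fps (fps F) := flow phi_d phi_q.

Let natU m : m.+1%:R \is a @GRing.unit F.
Proof. by rewrite unitfE. Qed.

Lemma phi_d_derivation : derivation phi_d.
Proof.
have dF := fps_deriv_derivation F; split=> a b; rewrite /phi_d.
  by rewrite (derD dF) mulrDr.
by rewrite (derM dF); ring.
Qed.

Lemma fps_deriv_phi_q : fps_deriv phi_q = 1.
Proof.
rewrite /phi_q (derD (fps_deriv_derivation F)) (der1 (fps_deriv_derivation F)) add0r.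
by apply: fpsP => -[|n]; rewrite fps_coef1 /= ?mul0rn.
Qed.

Lemma phi_flow_transcendental (P : {poly {poly fps (fps F)}}) :
    poly2_in (constants (fps_map (@fps_deriv F))) P -> P != 0 ->
  P.[phi_flow, fps_const phi_q] <> 0.
Proof.
have natU' := nat_unit_fps natU.
have dd := phi_d_derivation.
have q0 : coef phi_q 0 = 1 by rewrite /phi_q fps_coefD fps_coef1 /= addr0.
have char2 : (1 + 1 : F) != 0 by have := char0 1%N; rewrite mulr2n.
have [w0 qw0] : exists w0, phi_q * w0 = 1.
  by apply: fps_unit_coef0; rewrite q0 unitr1.
have w00 : coef w0 0 = 1.
  by have := congr1 (fun f => coef f 0) qw0; rewrite fps_coef0M q0 mul1r.
have qU : phi_q \is a GRing.unit by apply/unitrPr; exists w0.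
have [z Tz] : exists z, phi_flow * z = 1 by apply: fps_unit_coef0.
have [g0 wg0] : exists g0, (1 + w0) * g0 = 1.
  by apply: fps_unit_coef0; rewrite fps_coefD w00 fps_coef1 unitfE.
have dT : fps_deriv phi_flow = Phi phi_flow.
  rewrite /phi_flow (flow_d dd natU') {2}/phi_d fps_deriv_phi_q mulr1.
  exact: (rmorph_Phi (flow_morph dd natU')).
apply: (@flow_transcendental _ _ _ _ (fps_const w0) z (fps_const g0)) => //.
- exact/fps_map_derivation/fps_deriv_derivation.
- exact/fps_char0/fps_char0.
- apply: fpsP => n; rewrite fps_coef1 /=; case: n => [|n] /=.
    exact: fps_deriv_phi_q.
  exact: (der0 (fps_deriv_derivation F)).
(* The time derivative of T is Phi(T) because the flow is a morphism, and Phi(q) dT/dq by the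
   definition of the flow. *)
- rewrite -dT /phi_flow flowP //; apply: fpsP => n.
  by rewrite -rmorph_Phi fps_coefCM.
- by rewrite -rmorphM qw0 rmorph1.
- by rewrite -[1](rmorph1 (@fps_const (fps F))) -rmorphD -rmorphM wg0.
(* The coefficient of s in T is Phi(q), with value 2 at q = 1, whereas q does not involve s. *)
- have T1 : coef phi_flow 1 = Phi phi_q.
    have := congr1 (@fps_coef0 _) dT; rewrite rmorph_Phi => <-.
    by rewrite /fps_coef0 /= mulr1n.
  apply/eqP => /(congr1 (fun f => coef (coef f 1) 0)); rewrite T1.
  have -> : coef (Phi phi_q) 0 = Phi (coef phi_q 0) := rmorph_Phi (@fps_coef0 F) _.
  by rewrite q0 /Phi !expr1n => /eqP; rewrite (negPf char2).
- apply/eqP => /(congr1 (fun f => coef (coef f 0) 0)).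
  rewrite [LHS]q0 => /eqP; rewrite !fps_coefN /=.
  by rewrite -addr_eq0 (negPf char2).
Qed.

End FlowOfPhi.

(** * From a solution and its Taylor expansion to an indeterminate and its flow *)

Section Transfer.
Variable k : fieldType.
Hypothesis char0 : forall m, m.+1%:R != 0 :> k.

Local Notation Om := {fraction (fps k)}.

Definition const_frac : k -> Om := @FracField.tofrac (fps k) \o @fps_const k.
HB.instance Definition _ := GRing.RMorphism.on const_frac.

Lemma char0_Om m : m.+1%:R != 0 :> Om.
Proof.
by rewrite -(rmorph_nat (@FracField.tofrac (fps k))) tofrac_eq0 fps_char0.
Qed.

Let natU m : m.+1%:R \is a @GRing.unit k.
Proof. by rewrite unitfE. Qed.

(** The expansion a(x + s), as a series in s over the fraction field of k[[x]]. *)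
Definition taylor : fps k -> fps Om :=
  fps_map (@FracField.tofrac (fps k)) \o
  flow_morph (fps_deriv_derivation k) (nat_unit_fps natU).
HB.instance Definition _ := GRing.RMorphism.on taylor.

Lemma taylor_coef a m : exists c : k,
  coef (taylor a) m = const_frac c * (iter m (@fps_deriv k) a)%:F.
Proof.
suff [c cE] : exists c : k, flow_coef (@fps_deriv k) a m =
    fps_const c * iter m (@fps_deriv k) a.
  by exists c; rewrite /const_frac /= cE rmorphM.
have dk := fps_deriv_derivation k.
elim: m => [|m [c IH]]; first by exists 1; rewrite rmorph1 mul1r.
exists (m.+1%:R^-1 * c); rewrite /= IH (derM dk).
have -> : fps_deriv (fps_const c) = 0 by apply: fpsP => n /=; rewrite mul0rn.
rewrite mul0r add0r rmorphM -mulrA; congr (_ * _).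
apply: (mulrI (nat_unit_fps natU m)); rewrite mulrV ?nat_unit_fps //.
by rewrite -(rmorph_nat (@fps_const k)) -rmorphM mulfV ?rmorph1.
Qed.

Lemma taylor_inj : injective taylor.
Proof.
move=> a b /(congr1 (fun f => coef f 0)) /=; exact: tofrac_inj.
Qed.

(** The universal flow of [Phi], with polynomial coefficients. Evaluating them at any r with d r =
    Phi(r) gives the flow of r, so the solution h and the indeterminate q are two specialisations of
    one series. *)
Definition poly_flow : fps {poly k} := flow (fun p => Phi 'X * p^`()) 'X.

Lemma poly_flow_map (R : comUnitRingType) (d : R -> R) (c : {rmorphism k -> R}) (r : R) :
    (forall m, m.+1%:R \is a @GRing.unit R) -> derivation d ->
    (forall a, d (c a) = 0) -> d r = Phi r ->
  fps_map (horner_eval r \o map_poly c) poly_flow = flow d r.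
Proof.
move=> natR dd dc dr; pose ev : {rmorphism {poly k} -> R} := horner_eval r \o map_poly c.
have evX : ev 'X = r by rewrite /ev /= /horner_eval map_polyX hornerX.
rewrite -[in RHS]evX.
apply: (flow_map (rho := ev) _ (nat_unit_poly char0) natR) => p.
rewrite rmorphM rmorph_Phi evX /ev /= /horner_eval (der_horner dd) -deriv_map dr.
set s := \poly_(i < _) _; have -> : s = 0.
  apply/polyP => i; rewrite coef_poly coef0; case: ifP => // _.
  by rewrite coef_map; apply: dc.
by rewrite horner0 add0r mulrC.
Qed.

(* A relation between h and its Taylor expansion, with coefficients over which h is
   transcendental, remains true when h is replaced by an indeterminate q. *)
Lemma taylor_transcendental (L : set Om) (h : fps k) (P : {poly {poly fps Om}}) :
    subfield_set L -> (forall c, L (const_frac c)) ->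
    fps_deriv h = Phi h -> ~ alg L h%:F ->
    poly2_in (fps_in L) P -> P != 0 ->
  P.[taylor h, fps_const h%:F] <> 0.
Proof.
move=> HL Lk hE hL LP P0 Ph.
pose T1 : fps {poly Om} := fps_map (map_poly const_frac) poly_flow.
pose emb : {rmorphism fps Om -> fps {poly Om}} := fps_map (@polyC Om).
pose P1 := map_poly (map_poly emb) P.
pose Z := P1.[T1, fps_const 'X].
have const_der (F : comNzRingType) (a : F) : fps_deriv (fps_const a) = 0.
  by apply: fpsP => n /=; rewrite mul0rn.
have evZ : fps_map (horner_eval h%:F) Z = 0.
  pose ev : {rmorphism fps {poly Om} -> fps Om} := fps_map (horner_eval h%:F).
  have evT1 : ev T1 = taylor h.
    transitivity (fps_map (@FracField.tofrac (fps k)) (flow (@fps_deriv k) h)); last by [].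
    rewrite -(poly_flow_map (c := @fps_const k) (nat_unit_fps natU)
      (fps_deriv_derivation k)) //;
      last exact: const_der.
    apply: fpsP => n; rewrite /ev /T1 !coef_fps_map /= /horner_eval.
    by rewrite /const_frac map_poly_comp horner_map.
  have evX : ev (fps_const 'X) = fps_const h%:F.
    by rewrite /ev /= fps_map_const /= /horner_eval hornerX.
  have PE : map_poly (map_poly ev) P1 = P.
    apply/polyP => i; apply/polyP => j; rewrite /P1 !coef_map /=.
    by apply: fpsP => n; rewrite /= /horner_eval hornerC.
  transitivity (P.[taylor h, fps_const h%:F]); last exact: Ph.
  rewrite -[LHS]/(ev Z) /Z -horner2_map evT1 evX PE.
  by [].
have HPL := fps_in_subring (poly_in_subring HL.1).
have ZL : fps_in (poly_in L) Z.
  rewrite /Z (horner2_coef _ _ (leqnn _)); apply: (subring_sum HPL) => i _.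
  apply: (subringM HPL).
    apply: (subring_horner HPL).
      by move=> j n; rewrite /P1 !coef_map /=; apply: (poly_inC HL.1); apply: LP.
    exact: (fps_in_const (poly_in_subring HL.1) (poly_inX HL.1)).
  by apply: (subringX HPL) => n j; rewrite /T1 /= coef_map.
(* Each coefficient of [Z] in s is a polynomial over [L] vanishing at h, which is transcendental
   over [L]. *)
have Z0 : Z = 0.
  apply: fpsP => n; apply/eqP/negPn/negP => Zn; apply: hL; exists (coef Z n); split=> //.
  exact/rootP/(congr1 (fun f => coef f n) evZ).
(* The vanishing of [Z] is an identity in X, so X may now be replaced by q. *)
pose psi : {rmorphism {poly Om} -> fps Om} :=
  horner_eval (phi_q Om) \o map_poly (@fps_const Om).
pose psi' : {rmorphism fps {poly Om} -> fps (fps Om)} := fps_map psi.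
have psiT1 : psi' T1 = phi_flow Om.
  pose c : {rmorphism k -> fps Om} := @fps_const Om \o const_frac.
  have natO m : m.+1%:R \is a @GRing.unit Om by rewrite unitfE char0_Om.
  rewrite /phi_flow -(poly_flow_map (c := c) (nat_unit_fps natO) (phi_d_derivation Om)).
  - apply: fpsP => n; rewrite /psi' /T1 !coef_fps_map /=; congr (horner_eval _ _).
    by rewrite -map_poly_comp.
  - by move=> a; rewrite /phi_d const_der mulr0.
  - by rewrite /phi_d fps_deriv_phi_q mulr1.
have psiX : psi' (fps_const 'X) = fps_const (phi_q Om).
  by rewrite /psi' /= fps_map_const /= /horner_eval map_polyX hornerX.
have := congr1 psi' Z0; rewrite rmorph0 /Z -horner2_map psiT1 psiX.
apply: (phi_flow_transcendental char0_Om).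
  move=> i j; rewrite /constants /mkset !coef_map /=.
  apply: fpsP => n; rewrite /= /horner_eval map_polyC hornerC; exact: const_der.
apply: contraNneq P0 => P20; apply/eqP/polyP => i; apply/polyP => j.
have := congr1 (fun Q : {poly {poly fps (fps Om)}} => Q`_i`_j) P20.
rewrite !coef_map !coef0 /= => PE; apply: fpsP => n.
have := congr1 (fun f => coef (coef f n) 0) PE.
by rewrite /= /horner_eval map_polyC hornerC.
Qed.

End Transfer.

(** The elements of [e] are adjoined one at a time as long as h stays transcendental. If adjoining x
    would make h algebraic, then x is already algebraic over L(h), by exchange, and [L] is kept. *)
Lemma adjoin_all (E : fieldType) (K : set E) (h : E) (e : seq E) :
    subfield_set K -> ~ alg K h ->
  exists L, [/\ subfield_set L, K `<=` L, ~ alg L h & forall x, x \in e -> alg (adj L h) x].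
Proof.
move=> HK Kh; elim: e => [|x e [L [HL KL Lh Le]]].
  by exists K; split=> // x; rewrite in_nil.
have [xh|xh] := pselect (alg (adj L x) h).
  exists L; split=> // y; rewrite inE => /predU1P [->|/Le //].
  exact: (alg_exchange HL.1 xh Lh).
have Hx := adj_subfield HL.1 x; have Lx := adj_base HL.1 x.
exists (adj L x); split=> //.
  by move=> y /KL; apply: Lx.
move=> y; rewrite inE => /predU1P [->|/Le].
  by apply: (alg_id (adj_subfield Hx.1 h).1); apply: (adj_base Hx.1); apply: (adj_gen HL.1).
by apply: alg_sub; apply: adj_sub.
Qed.

(** * Descent from one level of the tower to the level below *)

Section DescentStep.
Variable k : fieldType.
Hypothesis char0 : forall m, m.+1%:R != 0 :> k.

Local Notation Om := {fraction (fps k)}.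
Let dx (i : 'I_1) := @fps_deriv k.

Lemma dx_derivation i : derivation (dx i). Proof. exact: fps_deriv_derivation. Qed.

Lemma alg_Phi_D (R : set (fps k)) h : diffring_set dx R ->
    (forall c, R (fps_const c)) -> fps_deriv h = Phi h ->
  alg (D dx R) h -> alg R h.
Proof.
move=> HR Rc hE; apply: contraPP => /(alg_frac _ HR.1) Rh [p [Dp p0 ph]].
have HK := Frac_subfield HR.
have [f fP] := choice (fun i => D_elim HR (Dp i)).
(* One list whose span contains all derivatives of all coefficients of [p]. *)
pose e := flatten [seq f i | i <- iota 0 (size p)].
have [L [HL KL Lh Le]] := adjoin_all e HK Rh.
have Lk c : L (const_frac c) by apply/KL/(Frac_id HR)/Rc.
pose C := fps_in L; have HC : subring_set C := fps_in_subring HL.1.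
have HS := frac_image_subring HC; set S := frac_image C in HS.
pose q : {fraction fps Om} := (fps_const h%:F)%:F.
(* From a relation over L[[s]], taking the coefficient of a suitable s^n gives a relation for h over
   [L]. *)
have Sq : ~ alg S q.
  move=> /(alg_frac_image _ HC) [r [Cr r0 rq]]; apply: Lh.
  have [i [n rin]] : exists i n, coef r`_i n != 0.
    apply: contrapT => nex; case/eqP: r0; apply/polyP => i; apply: fpsP => n.
    by rewrite coef0; apply/eqP/negPn/negP => rin; apply: nex; exists i, n.
  exists (\poly_(i < size r) coef r`_i n); split.
  - by move=> j; rewrite coef_poly; case: ifP => _; [apply: Cr | apply: (subring0 HL.1)].
  - apply: contraNneq rin => /(congr1 (fun s : {poly _} => s`_i)).
    rewrite coef_poly coef0; case: ltnP => [_ -> //|/(nth_default 0) ->].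
    by rewrite eqxx.
  - rewrite rootE horner_poly; apply/eqP.
    apply: etrans (congr1 (fun g => coef g n) (rootP rq)).
    rewrite horner_coef fps_coef_sum.
    apply: eq_bigr => j _; rewrite -(rmorphXn (@fps_const Om)) [in RHS]mulrC [LHS]mulrC.
    exact/esym/fps_coefCM.
have Hq := adj_subfield HS q; pose M := alg (adj S q); have HM := alg_subfield Hq.
have SM : S `<=` M by move=> a Sa; apply: (alg_id Hq.1); apply: (adj_base HS).
have eM x : x \in e -> M (fps_const x)%:F.
  move=> /Le /(alg_adj HL.1) [P [LP P0 Pxh]].
  pose g : {rmorphism Om -> {fraction fps Om}} :=
    @FracField.tofrac (fps Om) \o @fps_const Om.
  apply: (adj_alg HS (P := map_poly (map_poly g) P)) => //.
  - move=> i j; rewrite !coef_map /=; exists (fps_const (P`_i)`_j) => //.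
    by apply: (fps_in_const HL.1); apply: LP.
  - by rewrite map_poly2_eq0 // => a b /tofrac_inj /fps_const_inj.
  - by rewrite (horner2_map g) Pxh rmorph0.
(* Expanding each derivative over [e] and collecting the powers of s, a(x + s) becomes a combination
   of the elements of [e] with coefficients in L[[s]]. *)
have taylorM i : M (taylor char0 p`_i)%:F.
  have [i_p|/(nth_default 0) ->] := ltnP i (size p); last first.
    by rewrite !rmorph0; apply: (subring0 HM.1).
  have cP m : exists c : nat -> Om, (forall j, L (c j)) /\
      coef (taylor char0 p`_i) m = \sum_(j < size e) c j * e`_j.
    have [c cE] := taylor_coef char0 p`_i m.
    suff : lspan L [set` e] (coef (taylor char0 p`_i) m) by apply: lspan_seqP.
    have [S0 SD SZ] := lspan_subspace HL [set` e].
    rewrite cE; apply: (SZ); first exact: Lk.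
    have pm : partials dx p`_i (iter m (@fps_deriv k) p`_i).
      by exists (nseq m ord0) => //; elim: m {c cE} => //= m ->.
    have := fP i _ pm; apply: lspan_le; first by split=> // c' v /KL; apply: SZ.
    move=> x xf; apply: (lspan_gen HL); apply/flattenP; exists (f i) => //.
    by apply/mapP; exists i; rewrite ?mem_iota.
  have [c {}cP] := choice cP.
  have -> : taylor char0 p`_i = \sum_(j < size e) Fps (fun m => c m j) * fps_const e`_j.
    apply: fpsP => m; rewrite fps_coef_sum (cP m).2; apply: eq_bigr => j _.
    rewrite [in RHS]mulrC [LHS]mulrC; exact/esym/fps_coefCM.
  rewrite rmorph_sum; apply: (subring_sum HM.1) => j _; rewrite rmorphM.
  apply: (subringM HM.1).
    by apply: SM; exists (Fps (fun m => c m j)) => // m; apply: (cP m).1.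
  by apply/eM/mem_nth.
(* The Taylor morphism, applied to p(h) = 0, shows that h(x + s) is algebraic over [M], hence over
   L[[s]] and h. *)
have [|P' [SP' P'0 P'h]] := alg_adj HS (u := (taylor char0 h)%:F) (v := q).
  apply: (alg_trans Hq); pose g : {rmorphism fps k -> {fraction fps Om}} :=
    @FracField.tofrac (fps Om) \o taylor char0.
  exists (map_poly g p); split.
  - by move=> i; rewrite coef_map; apply: taylorM.
  - rewrite -size_poly_eq0 size_map_inj_poly ?rmorph0 ?size_poly_eq0 //.
    by move=> a b /tofrac_inj /taylor_inj.
  - by rewrite rootE (horner_map g) (rootP ph) rmorph0.
have [P CP P'E] := poly2_in_image (subring0 HC) SP'.
apply: (taylor_transcendental (char0 := char0) HL Lk hE Lh CP).
  by apply: contraNneq P'0; rewrite P'E => ->; rewrite rmorph0.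
by apply: tofrac_inj; rewrite rmorph0 -P'h P'E horner2_map.
Qed.

End DescentStep.

Section Univariate.
Variable k : fieldType.
Hypothesis char0 : forall m, m.+1%:R != 0 :> k.

Let dx (i : 'I_1) := @fps_deriv k.
Let dxP : forall i, derivation (dx i) := @dx_derivation k.

Lemma range_const_diffring : diffring_set dx (range (@fps_const k)).
Proof.
split; last first.
  move=> i _ [c _ <-]; exists 0 => //; apply: fpsP => n.
  by rewrite rmorph0 /= mul0rn.
split; first by exists 1; rewrite ?rmorph1.
  by move=> _ _ [a _ <-] [b _ <-]; exists (a - b); rewrite ?rmorphB.
by move=> _ _ [a _ <-] [b _ <-]; exists (a * b); rewrite ?rmorphM.
Qed.

Lemma kx_diffring : diffring_set dx (kx (k := k)).
Proof.
split; last by move=> i _ [p _ <-]; exists p^`(); rewrite ?fps_poly_deriv.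
split; first by exists 1; rewrite ?rmorph1.
  by move=> _ _ [p _ <-] [q _ <-]; exists (p - q); rewrite ?rmorphB.
by move=> _ _ [p _ <-] [q _ <-]; exists (p * q); rewrite ?rmorphM.
Qed.

(** Adds the constants as a level below k[x]: the monomials of degree less than [size p] span a
    stable space over k. *)
Lemma kx_sub_D : kx (k := k) `<=` D dx (range (@fps_const k)).
Proof.
move=> _ [p _ <-]; have HR := range_const_diffring; have HK := Frac_subfield HR.
pose e := [seq fps_poly ('X^i : {poly k}) | i <- iota 0 (size p)].
have eP i : (i < size p)%N ->
    lspan (Frac (range (@fps_const k))) [set` frac_seq e] (fps_poly ('X^i : {poly k}))%:F.
  move=> ip; apply: (lspan_gen HK); apply/mapP; exists (fps_poly 'X^i) => //.
  by apply/mapP; exists i; rewrite ?mem_iota.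
have [S0 SD SZ] := lspan_subspace HK [set` frac_seq e].
have Kc c : Frac (range (@fps_const k)) (fps_const c)%:F by apply: (Frac_id HR); exists c.
apply: (D_stable dxP HR (e := e)) => [i x /mapP [j]|].
  rewrite mem_iota add0n => /andP [_ jp] ->.
  rewrite /dx -fps_poly_deriv derivXn -scaler_nat -mul_polyC rmorphM /= fps_polyC rmorphM.
  apply: (SZ); first exact: Kc.
  by apply: eP; apply: leq_ltn_trans jp; apply: leq_pred.
rewrite -[p]coefK poly_def rmorph_sum rmorph_sum.
apply: subspace_sum; first exact: lspan_subspace.
move=> i _; rewrite -mul_polyC rmorphM /= fps_polyC rmorphM.
by apply: (SZ); [apply: Kc | apply: eP].
Qed.

Lemma Phi_not_Dinf_x (h : fps k) :
  fps_deriv h = Phi h -> coef h 0 = 1 -> ~ Dinf_x (k := k) h.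
Proof.
move=> hE h0 /Dinf_Dn_ex [j hj].
have HD := Dn_diffring dxP kx_diffring.
have kx_const i c : Dn dx (kx (k := k)) i (fps_const c).
  by apply: (Dn_mono dxP kx_diffring (leq0n i)); exists c%:P; rewrite ?fps_polyC.
have alg_j i : ~ alg (Dn dx (kx (k := k)) i) h.
  elim: i => [|i IH]; last first.
    by move=> /(alg_Phi_D char0 (HD i) (kx_const i) hE) /IH.
  move=> /(alg_sub kx_sub_D) /(alg_Phi_D char0 range_const_diffring) [||p [Rp p0 ph]] //.
  have : alg (constants (@fps_deriv k)) h.
    exists p; split=> // i; have [c _ <-] := Rp i.
    by apply: fpsP => n /=; rewrite mul0rn.
  move=> /(alg_constants (fps_deriv_derivation k) (fps_char0 char0)).
  rewrite hE => /(congr1 (@fps_coef0 k)); rewrite rmorph_Phi /= /fps_coef0 h0.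
  by rewrite /Phi !expr1n => /eqP; have := char0 1%N; rewrite mulr2n => /negPf ->.
by apply: (alg_j j); apply: (alg_id (HD j).1).
Qed.

End Univariate.

(** * Failure of the preparation *)

Section Counterexample.
Variable k : fieldType.
Hypothesis char0 : forall m, m.+1%:R != 0 :> k.

Lemma exists_inv_Phi : exists G : fps k, Phi (phi_q k) * G = 1 /\ coef G 0 != 0.
Proof.
have q0 : coef (Phi (phi_q k)) 0 = 1 + 1.
  have -> : coef (Phi (phi_q k)) 0 = Phi (coef (phi_q k) 0) := rmorph_Phi (@fps_coef0 k) _.
  by rewrite /phi_q fps_coefD fps_coef1 /= addr0 /Phi !expr1n.
have [|G GE] := fps_unit_coef0 (f := Phi (phi_q k)).
  by rewrite q0 unitfE; have := char0 1%N; rewrite mulr2n.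
exists G; split=> //; apply/eqP => G0.
have := congr1 (fun f => coef f 0) GE; rewrite fps_coef0M G0 mulr0 => /eqP.
by rewrite eq_sym oner_eq0.
Qed.

Definition primitive (f : fps k) : fps k :=
  Fps (fun n => if n is m.+1 then coef f m / m.+1%:R else 0).

Lemma primitiveK f : fps_deriv (primitive f) = f.
Proof. by apply: fpsP => n /=; rewrite -[LHS]mulr_natr divfK. Qed.

(* F = g(y) - x with g'(y) = 1/Phi(1 + y): its root y(x) makes 1 + y(x) a solution
   of h' = Phi h. *)
Definition counterexample (G : fps k) : fps (fps k) :=
  fps_map (@fps_const k) (primitive G) - fps_const (fps_X k).

Lemma d_x_counterexample G : d_x (counterexample G) = -1.
Proof.
rewrite /counterexample (derB (d_x_derivation k)).
apply: fpsP => n; apply: fpsP => m; rewrite !fps_coefB !fps_coefN !fps_coef1 /=.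
rewrite mul0rn sub0r; case: n => [|n] /=; last by rewrite mul0rn oppr0.
by case: m => [|m]; rewrite ?mul0rn.
Qed.

Lemma d_y_counterexample G : d_y (counterexample G) = fps_map (@fps_const k) G.
Proof.
rewrite /counterexample (derB (d_y_derivation k)) /d_y -fps_map_deriv primitiveK.
have -> : fps_deriv (fps_const (fps_X k)) = 0 by apply: fpsP => n /=; rewrite mul0rn.
by rewrite subr0.
Qed.

(** Over k(x, y) the series F and 1 span all partials: dF/dx = -1, and dF/dy = 1/Phi(1 + y) is
    rational. So F appears at the first level of the tower. *)
Lemma counterexample_Dinf G : Phi (phi_q k) * G = 1 -> Dinf_xy (counterexample G).
Proof.
move=> GE; rewrite Dinf_xyE.
have HR := kxy_diffring k; have dd := @dxy_derivation k; have HK := Frac_subfield HR.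
apply: (Dinf_Dn dd HR (j := 1)).
pose e := [:: counterexample G; 1]; pose cst := fps_map (@fps_const k).
have [S0 SD SZ] := lspan_subspace HK [set` frac_seq e].
have S1 : lspan (Frac (kxy (k := k))) [set` frac_seq e] 1%:F.
  by apply: (lspan_gen HK); rewrite /= !inE eqxx orbT.
have SK a : Frac (kxy (k := k)) a%:F -> lspan (Frac (kxy (k := k))) [set` frac_seq e] a%:F.
  by move=> Ka; rewrite -[a]mulr1 rmorphM; apply: (SZ).
apply: (D_stable dd HR (e := e)) => [i a|]; last first.
  by apply: (lspan_gen HK); rewrite /= inE eqxx.
rewrite !inE => /pred2P [] ->; last by rewrite (der1 (dd i)) rmorph0.
apply: SK; rewrite /dxy; case: ifP => _.
  rewrite d_x_counterexample rmorphN.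
  by apply: (subringN HK.1); rewrite ?rmorph1; apply: (subring1 HK.1).
rewrite d_y_counterexample.
pose p : {poly {poly k}} := Phi (1 + 'X).
have pG : poly_xy p * cst G = 1.
  rewrite -(rmorph1 cst) -GE rmorphM; congr (_ * _).
  rewrite /poly_xy /p (rmorph_Phi (@fps_poly {poly k})) (rmorph_Phi (fps_map (@fps_poly k))).
  rewrite (rmorph_Phi cst); congr Phi; rewrite /phi_q !rmorphD !rmorph1 /= fps_polyX.
  by congr (_ + _); apply: fpsP => n; rewrite !coef_fps_map /= !rmorph_nat.
have p0 : (poly_xy p)%:F != 0.
  by rewrite tofrac_eq0; apply: contra_eq_neq pG => ->; rewrite mul0r eq_sym oner_neq0.
have -> : (cst G)%:F = ((poly_xy p)%:F)^-1.
  by apply: (mulfI p0); rewrite divff // -rmorphM pG rmorph1.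
by apply: (subfieldV HK); apply: (Frac_id HR); exists p.
Qed.

(* Reduction modulo y + h0 is evaluation at y = - h0(x). *)
Lemma const_multiple (c h0 : fps k) (v : fps (fps k)) : coef h0 0 = 0 ->
  fps_const c = (fps_X (fps k) + fps_const h0) * v -> c = 0.
Proof.
move=> h00 cE; have c0 : c = h0 * coef v 0.
  have := congr1 (fun f => coef f 0) cE.
  by rewrite mulrDl fps_coefD fps_coefXM fps_coefCM add0r.
(* Comparing coefficients of y^(j + 1) makes each coefficient of [v] a multiple of the next by h0,
   hence divisible by every power of x. *)
have vE j : coef v j = - h0 * coef v j.+1.
  have := congr1 (fun f => coef f j.+1) cE.
  rewrite mulrDl fps_coefD fps_coefXM fps_coefCM /= => /esym/eqP.
  by rewrite addr_eq0 mulNr => /eqP.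
have h0o : ordge 1 (- h0) by apply: ordge_opp; apply: ordge1.
suff v0 : coef v 0 = 0 by rewrite c0 v0 mulr0.
apply: ordge_eq0 => n; elim: n (0%N) => [|n IH] j; first by [].
by rewrite vE -[n.+1]/(1 + n)%N; apply: ordge_mul.
Qed.

(** With l = y + h0 and H = 1 - h0, the x-derivative of F = u l gives H' u = 1 modulo l, and the
    y-derivative gives u = 1/Phi(1 + y), where 1 + y is congruent to H. So H' and Phi(H) agree
    modulo l and, being free of y, are equal by [const_multiple]. *)
Lemma no_preparation :
  ~ admits_weierstrass_preparation (Dinf_xy (k := k)) (Dinf_x (k := k)).
Proof.
have [G [GE G0]] := exists_inv_Phi; set F := counterexample G.
have Fo : has_order (at_x0 F) 1.
  split=> [|[|//] _]; last by rewrite /= subr0.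
  by rewrite /= divr1 subr0.
move=> /(_ F 1%N (counterexample_Dinf GE) Fo) [u [h [_ _ hP FE]]].
have [Dh h00] := hP ord0; pose h0 := h ord0; rewrite -/h0 in Dh h00.
pose l := fps_X (fps k) + fps_const h0.
have {}FE : F = u * l.
  by rewrite FE /weierstrass_poly big_ord1 expr1 subnn expr0 mulr1.
have dX := fps_deriv_derivation k.
pose H := 1 - h0.
have H0 : coef H 0 = 1 by rewrite fps_coefB h00 subr0 fps_coef1.
have HH : fps_deriv H = Phi H; last first.
  apply: (Phi_not_Dinf_x char0 HH H0); have dd := @dx_derivation k.
  have HS := Dinf_subring dd (kx_diffring k).
  by apply: (subringB HS) => //; apply: (subring1 HS).
pose cst := fps_map (@fps_const k); pose q : fps (fps k) := 1 + fps_X (fps k).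
have Ex : fps_const (fps_deriv H) * u = 1 + d_x u * l.
  have := congr1 (@d_x k) FE; rewrite (derM (d_x_derivation k)) d_x_counterexample => dF.
  have dl : d_x l = - fps_const (fps_deriv H).
    rewrite (derB dX) (der1 dX) sub0r rmorphN opprK.
    apply: fpsP => n; rewrite /l (derD (d_x_derivation k)) fps_coefD /=.
    have -> : fps_deriv ((n == 1%N)%:R : fps k) = 0.
      by rewrite -(rmorph_nat (@fps_const k)); apply: fpsP => m /=; rewrite mul0rn.
    by rewrite add0r; case: eqP => // _; rewrite (der0 dX).
  have <- : - (-1) = 1 :> fps (fps k) by rewrite opprK.
  by rewrite dF dl; ring.
have Ey : cst G = d_y u * l + u.
  have := congr1 (@d_y k) FE; rewrite d_y_counterexample -/cst => ->.
  rewrite (derM (d_y_derivation k)); congr (_ + _).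
  have -> : d_y l = 1; last by rewrite mulr1.
  rewrite /l (derD (d_y_derivation k)); apply: fpsP => n.
  by rewrite fps_coefD fps_coef1 /=; case: n => [|n]; rewrite ?mul0rn addr0.
have Eg : Phi q * cst G = 1.
  rewrite -(rmorph1 cst) -GE rmorphM; congr (_ * _).
  rewrite (rmorph_Phi cst); congr Phi; rewrite /q /phi_q rmorphD rmorph1; congr (_ + _).
  by apply: fpsP => n; rewrite coef_fps_map /= rmorph_nat.
have Eq : q = fps_const H + l.
  by rewrite /q /l /H rmorphB rmorph1 [_ + fps_const h0]addrC addrA subrK.
apply/eqP; rewrite -subr_eq0; apply/eqP.
pose A := Phi q; pose C : fps (fps k) := fps_const (Phi H).
(* The divided difference of [Phi] between q and H. *)
pose s := q + fps_const H + (q ^+ 2 + q * fps_const H + fps_const H ^+ 2).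
have AE : A = C + l * s.
  have lE : l = q - fps_const H by rewrite Eq addrC addKr.
  by rewrite /A /C (rmorph_Phi (@fps_const (fps k))) lE /s /Phi; ring.
(* The cofactor of l in H' - Phi(H), found by eliminating [u] between [Ex] and [Ey] multiplied by
   Phi(q). *)
apply: (const_multiple (h0 := h0)
  (v := C * d_x u + fps_const (fps_deriv H) * (A * d_y u + s * u)) h00).
rewrite -/l rmorphB -/C.
have -> : l * (C * d_x u + fps_const (fps_deriv H) * (A * d_y u + s * u)) =
    C * (1 + d_x u * l) - C + fps_const (fps_deriv H) *
      (A * (d_y u * l + u) - A * u + l * s * u) by ring.
by rewrite -Ex -Ey Eg AE; ring.
Qed.

End Counterexample.

Theorem corollary3p5 (k : fieldType) (char0 : [pchar k] =i pred0) :
  (exists (A : comNzRingType) (iota : {rmorphism A -> fps (fps k)}),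
     [/\ injective iota, range iota = Dinf_xy (k:=k),
         regular_local A & henselian_local A]) /\
  ~ admits_weierstrass_preparation (Dinf_xy (k:=k)) (Dinf_x (k:=k)).
Proof.
have k0 m : m.+1%:R != 0 :> k by rewrite ((pcharf0P k).1 char0).
split; last exact: no_preparation.
have HS := Dinf_subring (@dxy_derivation k) (kxy_diffring k).
have Salg := Dinf_alg (@dxy_derivation k) (kxy_diffring k) (fps_char0 (fps_char0 k0)).
have Sx := Dinf_xy_x k; have Sy := Dinf_xy_y k; have Sres := @Dinf_xy_restrict k.
exists (subring_type HS), (val : {rmorphism subring_type HS -> fps (fps k)}); split.
- exact: val_inj.
- rewrite Dinf_xyE; apply/seteqP; split=> [_ [a _ <-]|f /(subring_lift HS) [a aE]].
    exact: subring_valP.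
  by exists a.
- exact: (regular_local_subring HS Sx Sy Sres Salg).
- exact: (henselian_local_subring HS Salg).
Qed.
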